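(* Let $X$ be a filtered space and let $X\times\mathbb R$ be equipped with the product filtration and a perversity $\overline p$. Denote also by $\overline p$ the perversity induced on $X$. Then the maps induced in blown-up intersection cohomology by the projection $\mathrm{pr}\colon X\times\mathbb R\to X$ and the canonical injections $I_0,I_1\colon X\to X\times\mathbb R$, $I_0(x)=(x,0)$, $I_1(x)=(x,1)$, satisfy $$(I_0\circ\mathrm{pr})^*=(I_1\circ\mathrm{pr})^*=\mathrm{id}$$ on $\mathscr H^*_{\overline p}(X\times\mathbb R;R)$.
   Context: $R$ is a commutative ring with unity. Filtered spaces. A filtered space is a Hausdorff space $X$ with a filtration by closed subspaces $\emptyset=X_{-1}\subseteq X_0\subseteq\dots\subseteq X_{n-1}\subsetneq X_n=X$; $n=\dim X$ is the formal dimension. Strata are the non-empty connected components of the $X_i\setminus X_{i-1}$; a stratum $S\subset X_i\setminus X_{i-1}$ has $\operatorname{codim}S=n-i$; it is regular if $\operatorname{codim}S=0$, singular otherwise. A perversity on $X$ is a map $\overline p$ from the set of strata to $\mathbb Z\cup\{\pm\infty\}$ with value $0$ on regular strata. The product filtration on $X\times\mathbb R$ is $(X\times\mathbb R)_i=X_i\times\mathbb R$ (formal dimension $n$); its strata are the $S\times\mathbb R$. The perversity induced on $X$ is $\overline p(S)=\overline p(S\times\mathbb R)$. Filtered simplices. A filtered singular simplex is a continuous map $\sigma\colon\Delta\to X$ from a euclidean simplex (with ordered vertices) with a join decomposition $\Delta=\Delta_0*\dots*\Delta_n$ (some $\Delta_i$ may be empty), compatible with the vertex order, such that $\sigma^{-1}(X_i)=\Delta_0*\dots*\Delta_i$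 for all $i$. It is regular if $\Delta_n\neq\emptyset$. A regular face operator is the inclusion $\delta_\ell\colon\nabla\to\Delta$ of a codimension-one face with $\nabla_i=\nabla\cap\Delta_i$ and $\nabla_n\ne\emptyset$. Blow-up. For an ordered simplicial complex $K$, $N_*(K)$ is its simplicial chain complex over $R$, $N^*(K)=\operatorname{Hom}(N_*(K),R)$ with $(\delta f)(v)=-(-1)^{|f|}f(\partial v)$, and $\mathbf 1_F$ is the cochain equal to $1$ on the simplex $F$ and $0$ on the others. For a simplex $E$, $\mathtt cE=E*[\mathtt v]$ is the cone with apex $\mathtt v$ as last vertex ($\mathtt c\emptyset=[\mathtt v]$); its faces are written $(F,0)=F$ ($\emptyset\ne F$ a face of $E$) and $(F,1)=F*[\mathtt v]$ ($F$ a possibly empty face of $E$). Put $|(F,\varepsilon)|=\dim F+\varepsilon$, with $|(\emptyset,1)|=0$. For a regular simplex $\Delta$ put $\widetilde N^*(\Delta)=N^*(\mathtt c\Delta_0)\otimes\dots\otimes N^*(\mathtt c\Delta_{n-1})\otimes N^*(\Delta_n)$ with the tensor product differential and basis $\mathbf 1_{(F,\varepsilon)}=\mathbf 1_{(F_0,\varepsilon_0)}\otimes\dots\otimes\mathbf 1_{(F_{n-1},\varepsilon_{n-1})}\otimes\mathbf 1_{F_n}$ ($\varepsilon_n=0$, $F_n\neq\emptyset$). For $\ell\in\{1,\dots,n\}$, $\|\mathbf 1_{(F,\varepsilon)}\|_\ell=-\infty$ if $\varepsilon_{n-\ell}=1$ and $=\sum_{i>n-\ell}|(F_i,\varepsilon_i)|$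 if $\varepsilon_{n-\ell}=0$; for a linear combination with non-zero coefficients take the maximum; $\|0\|_\ell=-\infty$. $\widetilde N^*(X;R)$ is the complex of families $\omega=(\omega_\sigma)_\sigma$ indexed by regular simplices $\sigma\colon\Delta\to X$, $\omega_\sigma\in\widetilde N^*(\Delta)$, with $\delta_\ell^*\omega_\sigma=\omega_{\sigma\circ\delta_\ell}$ for every regular face operator; $(\delta\omega)_\sigma=\delta(\omega_\sigma)$. For a singular stratum $S$, $\|\omega\|_S=\sup\{\|\omega_\sigma\|_{\operatorname{codim}S}: \sigma\text{ regular},\ \operatorname{im}\sigma\cap S\neq\emptyset\}$. $\omega$ is $\overline p$-allowable if $\|\omega\|_S\le\overline p(S)$ for all singular $S$. $\widetilde N^*_{\overline p}(X;R)$ is the complex of $\omega$ with $\omega,\delta\omega$ both $\overline p$-allowable; its cohomology is the blown-up intersection cohomology $\mathscr H^*_{\overline p}(X;R)$. Induced maps. If $g\colon X\to Y$ is a continuous map between filtered spaces of the same formal dimension with $g^{-1}(Y_i)=X_i$ for all $i$ (as is the case for $\mathrm{pr}$, $I_0$, $I_1$), then $g^*$ is defined by $(g^*\omega)_\sigma=\omega_{g\circ\sigma}$. *)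

(* Defs.v *)
From HB Require Import structures.
From mathcomp Require Import all_boot all_order all_algebra.
From mathcomp Require Import all_classical all_reals all_analysis.

Set Implicit Arguments.
Unset Strict Implicit.
Unset Printing Implicit Defensive.

Import Order.TTheory GRing.Theory Num.Theory.
Import numFieldNormedType.Exports.

Local Open Scope classical_set_scope.
Local Open Scope ring_scope.

(* [below F i] is F_{i-1}, with F_{-1} empty. *)
Definition below T (F : nat -> set T) (i : nat) : set T :=
  if i is j.+1 then F j else set0.

(* The fields force [skel i] to be the whole space for i >= n, so indexing the
   filtration by nat carries no more data than X_0, ..., X_n. *)
Record filteredSpace (n : nat) := FilteredSpace {
  fcarrier :> topologicalType;
  skel : nat -> set fcarrier;
  filtered_hausdorff : hausdorff_space fcarrier;
  skel_closed : forall i, closed (skel i);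
  skel_mono : forall i, skel i `<=` skel i.+1;
  skel_full : skel n = setT;
  skel_proper : below skel n `<` skel n
}.
Arguments skel {n} f i.

Definition layer n (X : filteredSpace n) (i : nat) : set X :=
  skel X i `\` below (skel X) i.
Arguments layer {n} X i.

Record stratum n (X : filteredSpace n) := Stratum {
  sdim : nat;
  sset : set X;
  stratumP : exists2 x, layer X sdim x &
    sset = connected_component (layer X sdim) x
}.

Definition codim n (X : filteredSpace n) (S : stratum X) : nat := (n - sdim S)%N.

Definition regular_stratum n (X : filteredSpace n) (S : stratum X) : Prop :=
  codim S = 0%N.

Definition singular_stratum n (X : filteredSpace n) (S : stratum X) : Prop :=
  ~ regular_stratum S.

Record perversity n (X : filteredSpace n) := Perversity {
  pval :> stratum X -> \bar int;
  pval_regular : forall S, regular_stratum S -> pval S = 0%E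
}.

Lemma layer_inj n (X : filteredSpace n) i j x :
  layer X i x -> layer X j x -> i = j.
Proof.
have homo : {homo skel X : i j / (i <= j)%N >-> i `<=` j}.
  apply: homo_leq => [A//|B A C AB BC|k]; last exact: skel_mono.
  exact: subset_trans BC.
wlog lij : i j / (i < j)%N.
  move=> H; case: (ltngtP i j) => //; first exact: H.
  by move=> ji xi xj; apply/esym/H.
case: j lij => // j ij [xi _] [_ nj].
by exfalso; apply: nj; apply: (homo i).
Qed.

Lemma layer_ex n (X : filteredSpace n) (x : X) : exists i, layer X i x.
Proof.
have H : exists i, `[< skel X i x >].
  by exists n; apply/asboolP; rewrite skel_full.
case: (ex_minnP H) => i /asboolP xi imin; exists i; split => //.
case: i xi imin => [_ _ []|i _ imin /= xi].
by have := imin i; rewrite ltnn => /(_ (asboolT xi)).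
Qed.

Lemma stratum_layer n (X : filteredSpace n) (S : stratum X) x :
  sset S x -> layer X (sdim S) x.
Proof.
by have [y _ ->] := stratumP S; move=> /connected_component_sub.
Qed.

Lemma stratum_component n (X : filteredSpace n) (S : stratum X) x :
  sset S x -> sset S = connected_component (layer X (sdim S)) x.
Proof.
by have [y _ eS] := stratumP S; rewrite {1 2}eS => /same_connected_component.
Qed.

Lemma stratum_meet n (X : filteredSpace n) (S T : stratum X) x :
  sset S x -> sset T x -> S = T.
Proof.
move=> Sx Tx.
have e := layer_inj (stratum_layer Sx) (stratum_layer Tx).
have := stratum_component Sx; have := stratum_component Tx.
case: S T Sx Tx e => i S Sp [j T Tp] /= Sx Tx e; subst j => eT eS.
have eST : S = T by rewrite eT eS.
by clear eS eT; subst T; rewrite (Prop_irrelevance Sp Tp).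
Qed.

Definition stratum_of n (X : filteredSpace n) i (x : X) (xi : layer X i x) :
  stratum X := Stratum (ex_intro2 _ _ x xi erefl).

Lemma stratum_ofP n (X : filteredSpace n) i (x : X) (xi : layer X i x) :
  sset (stratum_of xi) x.
Proof. exact: connected_component_refl. Qed.

Section Product.
Variables (RR : realType) (n : nat) (X : filteredSpace n).

Let XR : topologicalType := (X * RR)%type.
Let sk i : set XR := skel X i `*` setT.

Let XR_hausdorff : hausdorff_space XR.
Proof.
move=> [x s] [y t] cl; congr pair.
  apply: (@filtered_hausdorff _ X) => A B xA yB.
  have [||[z u] [/= Az Bz]] := cl (fst @^-1` A) (fst @^-1` B).
  - exact: (@cvg_fst _ _ (nbhs x) (nbhs s)).
  - exact: (@cvg_fst _ _ (nbhs y) (nbhs t)).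
  by exists z.
apply: (@Rhausdorff RR) => A B xA yB.
have [||[z u] [/= Az Bz]] := cl (snd @^-1` A) (snd @^-1` B).
- exact: (@cvg_snd _ _ (nbhs x) (nbhs s)).
- exact: (@cvg_snd _ _ (nbhs y) (nbhs t)).
by exists u.
Qed.

Let sk_closed i : closed (sk i).
Proof.
rewrite (_ : sk i = fst @^-1` skel X i); last first.
  by apply/seteqP; split=> [[x s] []//|[x s]]; split.
apply: preimage_closed; last exact: skel_closed.
move=> [x s] _; exact: (@cvg_fst _ _ (nbhs x) (nbhs s)).
Qed.

Let sk_mono i : sk i `<=` sk i.+1.
Proof. by move=> [x s] [/= xi _]; split => //=; exact: skel_mono. Qed.

Let sk_full : sk n = setT.
Proof. by apply/seteqP; split=> // -[x s] _; split; rewrite //= skel_full. Qed.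

Let sk_proper : below sk n `<` sk n.
Proof.
have [sub nsub] := skel_proper X.
have belowE i : below sk i = below (skel X) i `*` setT.
  by case: i => //=; rewrite set0X.
rewrite belowE; split; first by move=> [x s] [/= xn _]; split => //; exact: sub.
apply: contra_not nsub => H x xn.
by have [] := H (x, 0) (conj xn I).
Qed.

Definition prodR : filteredSpace n :=
  @FilteredSpace n XR sk XR_hausdorff sk_closed sk_mono sk_full sk_proper.

Lemma layer_prodR i : layer prodR i = layer X i `*` setT.
Proof.
rewrite /layer; case: i => [|i]; apply/seteqP; split=> -[x s] /=.
- by move=> [[xi _] nxi].
- by move=> [[xi nxi] _].
- by move=> [[xi _] nxi]; split => //; split => // xi'; apply: nxi.
- by move=> [[xi nxi] _]; split => // -[].
Qed.

Lemma inj_continuous (t : RR) : continuous (fun x : X => (x, t) : prodR).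
Proof.
move=> x; apply: (@cvg_pair _ _ _ _ (nbhs x) (nbhs t)); first exact: cvg_id.
exact: cvg_cst.
Qed.

Lemma pr_continuous : continuous (fst : prodR -> X).
Proof. by move=> [x s]; exact: (@cvg_fst _ _ (nbhs x) (nbhs s)). Qed.

Lemma connected_prodR (A : set X) :
  connected A -> connected (A `*` [set: RR] : set prodR).
Proof.
move=> cA; have [->|/set0P[a Aa]] := eqVneq A set0.
  by rewrite set0X; exact: connected0.
pose V : set prodR := [set (a, t) | t in [set: RR]].
pose H t : set prodR := [set (x, t) | x in A].
have cV : connected V.
  apply: connected_continuous_connected; first exact/connected_intervalP.
  apply: continuous_subspaceT => t.
  apply: (@cvg_pair _ _ _ _ (nbhs a) (nbhs t)); first exact: cvg_cst.
  exact: cvg_id.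
have cH t : connected (H t).
  apply: connected_continuous_connected => //.
  by apply: continuous_subspaceT; exact: inj_continuous.
rewrite (_ : _ `*` _ = \bigcup_(t in [set: RR]) (H t `|` V)).
  apply: bigcup_connected.
    by exists (a, 0) => t _; right; exists 0.
  move=> t _; apply: connectedU => //.
  by exists (a, t); split; [exists a|exists t].
apply/seteqP; split=> [[x t] [/= Ax _]|[x t] [s _ [|]]].
- by exists t => //; left; exists x.
- by move=> [y Ay [<- _]].
- by move=> [u _ [<- _]].
Qed.

Lemma component_prodR i x t : layer X i x ->
  connected_component (layer prodR i) (x, t) =
  connected_component (layer X i) x `*` setT.
Proof.
move=> xi; apply/seteqP; split=> [[y s]|].
- move=> [B [Bxt Bi cB] Bys]; split => //=.
  exists [set z.1 | z in B]; last by exists (y, s).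
  split.
  + by exists (x, t).
  + by move=> _ [z Bz <-]; have := Bi _ Bz; rewrite layer_prodR => -[].
  + apply: connected_continuous_connected => //.
    by apply: continuous_subspaceT; exact: pr_continuous.
- apply: connected_component_max.
  + by split => //; exact: connected_component_refl.
  + rewrite layer_prodR => -[y s] [/= /connected_component_sub yi _] //.
  + exact/connected_prodR/component_connected.
Qed.

Lemma stratum_prodR_subproof (S : stratum X) :
  exists2 z, layer prodR (sdim S) z &
    sset S `*` setT = connected_component (layer prodR (sdim S)) z.
Proof.
have [x xi eS] := stratumP S; exists (x, 0); first by rewrite layer_prodR.
by rewrite component_prodR // eS.
Qed.

Definition stratum_prodR (S : stratum X) : stratum prodR :=
  Stratum (stratum_prodR_subproof S).

Lemma perversity_restrict_subproof (p : perversity prodR) (S : stratum X) :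
  regular_stratum S -> p (stratum_prodR S) = 0%E.
Proof. by move=> S0; apply: pval_regular. Qed.

Definition perversity_restrict (p : perversity prodR) : perversity X :=
  Perversity (@perversity_restrict_subproof p).

End Product.
Arguments prodR : clear implicits.
Arguments prodR RR {n} X.

Section Simplices.
Variable RR : realType.

(* The standard simplex on the ordered vertices 0 < ... < d, in barycentric
   coordinates. *)
Definition Delta d : set 'rV[RR]_d.+1 :=
  [set t | (forall v, 0 <= t ord0 v) /\ \sum_v t ord0 v = 1].
Arguments Delta d : clear implicits.

(* The join decomposition Delta_0 * ... * Delta_n is recorded by the map
   [part] sending a vertex to the index of the factor containing it. Then
   Delta_0 * ... * Delta_i consists of the points whose barycentric coordinates
   vanish at the vertices v with part v > i. *)
Record fsimplex n (X : filteredSpace n) (d : nat) := FSimplex {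
  smap :> Delta d -> X;
  part : 'I_d.+1 -> 'I_n.+1;
  smap_continuous : continuous smap;
  part_mono : forall u v : 'I_d.+1, (u <= v)%N -> (part u <= part v)%N;
  smap_filtered : forall (i : nat) (t : Delta d), skel X i (smap t) <->
    (forall v, (i < part v)%N -> set_val t ord0 v = 0)
}.

Definition regular n (X : filteredSpace n) d (s : fsimplex X d) : bool :=
  [exists v, part s v == ord_max].

Record rsimplex n (X : filteredSpace n) (d : nat) := RSimplex {
  rfsimplex :> fsimplex X d;
  rsimplex_regular : regular rfsimplex
}.

Definition face_row d (l : 'I_d.+2) (t : 'rV[RR]_d.+1) : 'rV[RR]_d.+2 :=
  \row_v (if unlift l v is Some w then t ord0 w else 0).

Lemma face_row_lift d (l : 'I_d.+2) t w : face_row l t ord0 (lift l w) = t ord0 w.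
Proof. by rewrite mxE liftK. Qed.

Lemma face_row_self d (l : 'I_d.+2) t : face_row l t ord0 l = 0.
Proof. by rewrite mxE unlift_none. Qed.

Lemma face_row_Delta d (l : 'I_d.+2) (t : Delta d) :
  face_row l (set_val t) \in Delta d.+1.
Proof.
have [/= t0 t1] := set_mem (valP t).
rewrite inE; split=> [v|].
  by rewrite mxE; case: unliftP => // w _; exact: t0.
rewrite (bigD1_ord l) //= face_row_self add0r -[RHS]t1.
by apply: eq_bigr => w _; rewrite face_row_lift.
Qed.

(* The affine inclusion of the face opposite to the vertex l. *)
Definition face_map d (l : 'I_d.+2) (t : Delta d) : Delta d.+1 :=
  exist _ (face_row l (set_val t)) (face_row_Delta l t).

Lemma face_map_continuous d (l : 'I_d.+2) : continuous (face_map l).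
Proof.
apply: continuous_comp_initial.
rewrite (_ : _ \o _ = face_row l \o set_val) //.
move=> t; apply: continuous_comp; first exact: initial_continuous.
move=> /= A /nbhs_ballP[e e0 eA].
apply/nbhs_ballP; exists e => // u [_ tu]; apply: eA; split => // i v.
rewrite ord1 !mxE; case: unliftP => [w _|_]; last exact: ballxx.
exact: tu.
Qed.

Section Face.
Variables (n : nat) (X : filteredSpace n) (d : nat) (l : 'I_d.+2).
Variable (s : fsimplex X d.+1).

Let map := fun t : Delta d => s (face_map l t).
Let fpart := fun v : 'I_d.+1 => part s (lift l v).

Let map_continuous : continuous map.
Proof.
move=> t; apply: (@continuous_comp _ _ _ (face_map l) s).
  exact: face_map_continuous.
exact: smap_continuous.
Qed.

Let fpart_mono (u v : 'I_d.+1) : (u <= v)%N -> (fpart u <= fpart v)%N.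
Proof. by move=> uv; apply: part_mono; rewrite /= leq_bump2. Qed.

Let map_filtered (i : nat) (t : Delta d) : skel X i (map t) <->
  (forall v, (i < fpart v)%N -> set_val t ord0 v = 0).
Proof.
rewrite /map (smap_filtered s); split=> H v iv.
  by rewrite -(face_row_lift l); exact: H.
rewrite /= mxE; case: unliftP => // w vE; apply: H.
by rewrite /fpart -vE.
Qed.

Definition face : fsimplex X d := FSimplex map_continuous fpart_mono map_filtered.

End Face.

End Simplices.
Arguments Delta RR d : clear implicits.

Section Blowup.
Variables (R : comPzRingType) (n : nat).

(* A face (F, eps) of the cone c E, for E a face of the simplex with vertices
   0 < ... < d. The apex of the cone is its last vertex. *)
Definition cface d : Type := ({set 'I_d.+1} * bool)%type.

(* dim F + eps, with dim set0 = -1; the value on (set0, false), which is not a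
   face, is irrelevant. *)
Definition cdim d (a : cface d) : nat := (#|a.1| + a.2)%N.-1.

(* The coefficient of [a] in the simplicial boundary of [b]. *)
Definition bcoef d (b a : cface d) : R :=
  \sum_(w in b.1)
    (-1) ^+ #|[pred u in b.1 | (u < w)%N]| *+ (a == ((b.1 :\ w)%SET, b.2))
  + (-1) ^+ #|b.1| *+ (b.2 && (a == (b.1, false))).

(* The value on [b] of delta 1_a = -(-1)^|a| 1_a (boundary -). *)
Definition dcoef d (a b : cface d) : R := - (-1) ^+ cdim a * bcoef b a.

Definition is_cell d (part : 'I_d.+1 -> 'I_n.+1)
    (a : {ffun 'I_n.+1 -> cface d}) : bool :=
  [forall i, [forall (v | v \in (a i).1), part v == i] &&
             (0 < #|(a i).1| + (a i).2)%N]
  && ~~ (a ord_max).2.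

(* The indices (F, eps) of the basis 1_(F,eps) of the blown-up cochains of a
   simplex with join decomposition [part]. *)
Definition cell d (part : 'I_d.+1 -> 'I_n.+1) : Type :=
  {a : {ffun 'I_n.+1 -> cface d} | is_cell part a}.

Definition cell_dim d (part : 'I_d.+1 -> 'I_n.+1) (a : cell part) : nat :=
  (\sum_i cdim (val a i))%N.

(* N^*(c Delta_0) (x) ... (x) N^*(c Delta_(n-1)) (x) N^*(Delta_n), in
   coordinates with respect to the basis of the 1_(F,eps). *)
Definition blowup d (part : 'I_d.+1 -> 'I_n.+1) : Type := {ffun cell part -> R^o}.
HB.instance Definition _ d part := GRing.Lmodule.on (@blowup d part).

(* The coefficient of 1_b in
   sum_i (-1)^(|a_0| + ... + |a_(i-1)|) 1_(a_0) (x) ... (x) delta 1_(a_i) (x)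
   ... (x) 1_(a_n). *)
Definition tcoef d (a b : {ffun 'I_n.+1 -> cface d}) : R :=
  \sum_(i < n.+1)
    ((-1) ^+ (\sum_(j < n.+1 | (j < i)%N) cdim (a j))%N * dcoef (a i) (b i))
    *+ [forall (j : 'I_n.+1 | j != i), a j == b j].

Definition blowup_delta d (part : 'I_d.+1 -> 'I_n.+1) (c : blowup part) :
  blowup part := [ffun b => \sum_(a : cell part) tcoef (val a) (val b) * c a].

(* For 0 < l <= n. *)
Definition cell_norm (l : nat) d (part : 'I_d.+1 -> 'I_n.+1) (a : cell part) :
    \bar int :=
  if (val a (inord (n - l))).2 then -oo%E
  else ((\sum_(i < n.+1 | (n - l < i)%N) cdim (val a i))%N%:Z)%:E.

Definition blowup_norm (l : nat) d (part : 'I_d.+1 -> 'I_n.+1)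
    (c : blowup part) : \bar int :=
  \big[maxe/-oo%E]_(a : cell part | c a != 0) cell_norm l a.

Lemma cell_face_subproof d (l : 'I_d.+2) (part : 'I_d.+2 -> 'I_n.+1)
    (a : cell (fun v => part (lift l v))) :
  is_cell part [ffun i => ((lift l @: (val a i).1)%SET, (val a i).2)].
Proof.
case: a => a /= /andP[/forallP H e]; apply/andP; split; last by rewrite ffunE.
apply/forallP => i; rewrite ffunE /=.
have /andP[/forallP Hi Hn] := H i.
rewrite card_imset ?Hn ?andbT; last exact: lift_inj.
by apply/forallP => v; apply/implyP => /imsetP[w wa ->]; exact: (implyP (Hi w)).
Qed.

Definition cell_face d (l : 'I_d.+2) (part : 'I_d.+2 -> 'I_n.+1)
    (a : cell (fun v => part (lift l v))) : cell part :=
  exist [eta is_cell part] _ (@cell_face_subproof d l part a).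

Definition blowup_face d (l : 'I_d.+2) (part : 'I_d.+2 -> 'I_n.+1)
    (c : blowup part) : blowup (fun v => part (lift l v)) :=
  [ffun a => c (cell_face a)].

Lemma blowup_delta_is_linear d (part : 'I_d.+1 -> 'I_n.+1) :
  linear (@blowup_delta d part).
Proof.
move=> k c c'; apply/ffunP => b; rewrite !ffunE.
rewrite scaler_sumr -big_split /=; apply: eq_bigr => a _.
by rewrite !ffunE mulrDr /GRing.scale /= mulrCA.
Qed.

HB.instance Definition _ d part :=
  GRing.isLinear.Build R _ _ _ _ (@blowup_delta_is_linear d part).

Lemma blowup_face_is_linear d l (part : 'I_d.+2 -> 'I_n.+1) :
  linear (@blowup_face d l part).
Proof. by move=> k c c'; apply/ffunP => b; rewrite !ffunE. Qed.

HB.instance Definition _ d l part :=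
  GRing.isLinear.Build R _ _ _ _ (@blowup_face_is_linear d l part).

Lemma blowup_norm_le l d (part : 'I_d.+1 -> 'I_n.+1) (c : blowup part) x :
  (blowup_norm l c <= x)%E <-> forall a, c a != 0 -> (cell_norm l a <= x)%E.
Proof.
split=> [+ a ca|H].
  rewrite /blowup_norm (bigD1 a) //=.
  by apply: le_trans; rewrite le_max lexx.
rewrite /blowup_norm; elim/big_rec: _ => [|a y ca yx]; first exact: leNye.
by rewrite ge_max H.
Qed.

End Blowup.
Arguments blowup R {n d} part.

Lemma ereal_int_supremums (A : set (\bar int)) : supremums A !=set0.
Proof.
have [M|noM] := pselect (exists M : int, ubound A M%:E); last first.
  exists +oo%E; split=> [x _|b bA]; first exact: leey.
  case: b bA => [b| |] bA //; first by case: noM; exists b.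
  by case: noM; exists 0 => x /bA; rewrite leeNy_eq => /eqP ->; exact: leNye.
have [[m Am]|nom] := pselect (exists m : int, A m%:E); last first.
  exists -oo%E; split=> [x Ax|b _]; last exact: leNye.
  case: x Ax => [x| |] Ax //; first by case: nom; exists x.
  by case: M => M /(_ _ Ax); rewrite leye_eq.
case: M => M uM.
pose P (k : nat) := `[< A (M - k%:Z)%:E >].
have exP : exists k, P k.
  have mM := uM _ Am; rewrite lee_fin in mM.
  exists `|M - m|%N; apply/asboolP.
  by rewrite gez0_abs ?subr_ge0 // subKr.
case: (ex_minnP exP) => k /asboolP Ak kmin.
exists (M - k%:Z)%:E; split=> [x Ax|b]; last by apply.
case: x Ax => [x| |] Ax; last exact: leNye.
  have xM := uM _ Ax; rewrite lee_fin in xM.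
  have := kmin `|M - x|%N; rewrite /P gez0_abs ?subr_ge0 // subKr.
  rewrite asboolT // => /(_ isT) kM; rewrite lee_fin lerBrDl -lerBrDr.
  by rewrite -(@gez0_abs (M - x)) ?subr_ge0 // lez_nat.
by have := uM _ Ax; rewrite leye_eq.
Qed.

Lemma ereal_int_supremum_le (A : set (\bar int)) x :
  (supremum -oo%E A <= x)%E <-> forall y, A y -> (y <= x)%E.
Proof.
split=> [+ y Ay|H].
  apply: le_trans; apply: ge_supremum_Nmem => //; exact: ereal_int_supremums.
rewrite /supremum; case: ifPn => _; first exact: leNye.
case: xgetP => [y -> [_ ylb]|_]; [exact: ylb|exact: leNye].
Qed.

Section Cochains.
Variables (RR : realType) (R : comPzRingType) (n : nat).
Implicit Types X Y Z : filteredSpace n.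

(* Families (omega_sigma), not yet assumed compatible with the faces. *)
Definition family X : Type :=
  forall (d : nat) (s : rsimplex RR X d), blowup R (part s).

HB.instance Definition _ X := gen_eqMixin (family X).
HB.instance Definition _ X := gen_choiceMixin (family X).

Section FamilyModule.
Variable X : filteredSpace n.
Implicit Types f g h : family X.

Let addf f g : family X := fun d s => f d s + g d s.
Let oppf f : family X := fun d s => - f d s.
Let zerof : family X := fun d s => 0.
Let scalef (k : R) f : family X := fun d s => k *: f d s.

Lemma familyP f g : (forall d s, f d s = g d s) -> f = g.
Proof.
by move=> H; apply: functional_extensionality_dep => d;
  apply: functional_extensionality_dep => s.
Qed.

Let addfA : associative addf.
Proof. by move=> f g h; apply: familyP => d s; exact: addrA. Qed.
Let addfC : commutative addf.
Proof. by move=> f g; apply: familyP => d s; exact: addrC. Qed.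
Let add0f : left_id zerof addf.
Proof. by move=> f; apply: familyP => d s; exact: add0r. Qed.
Let addNf : left_inverse zerof oppf addf.
Proof. by move=> f; apply: familyP => d s; exact: addNr. Qed.

HB.instance Definition _ :=
  GRing.isZmodule.Build (family X) addfA addfC add0f addNf.

Let scalefA k k' f : scalef k (scalef k' f) = scalef (k * k') f.
Proof. by apply: familyP => d s; exact: scalerA. Qed.
Let scale1f : left_id 1 scalef.
Proof. by move=> f; apply: familyP => d s; exact: scale1r. Qed.
Let scalefDr : right_distributive scalef +%R.
Proof. by move=> k f g; apply: familyP => d s; exact: scalerDr. Qed.
Let scalefDl f : {morph scalef^~ f : k k' / k + k'}.
Proof. by move=> k k'; apply: familyP => d s; exact: scalerDl. Qed.

HB.instance Definition _ :=
  GRing.Zmodule_isLmodule.Build R (family X) scalefA scale1f scalefDr scalefDl.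

End FamilyModule.

Definition blowup_cochain X (k : nat) (w : family X) : Prop :=
  (forall d (s : rsimplex RR X d) a, w d s a != 0 -> cell_dim a = k) /\
  (forall d (l : 'I_d.+2) (s : rsimplex RR X d.+1) (r : regular (face l s)),
     blowup_face l (w d.+1 s) = w d (RSimplex r)).

Lemma family_eq X (w : family X) d (m : Delta RR d -> X) (pt : 'I_d.+1 -> 'I_n.+1)
    (c c' : continuous m)
    (o o' : forall u v : 'I_d.+1, (u <= v)%N -> (pt u <= pt v)%N)
    (f f' : forall (i : nat) t, skel X i (m t) <->
       forall v, (i < pt v)%N -> set_val t ord0 v = 0)
    (r : regular (FSimplex c o f)) (r' : regular (FSimplex c' o' f')) :
  w d (RSimplex r) = w d (RSimplex r') :> blowup R pt.
Proof.
have := Prop_irrelevance c c'; have := Prop_irrelevance o o'.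
have := Prop_irrelevance f f' => ? ? ?; subst c' o' f'.
by rewrite (Prop_irrelevance r r').
Qed.

Definition family_delta X (w : family X) : family X :=
  fun d s => blowup_delta (w d s).

Definition stratum_norm X (w : family X) (S : stratum X) : \bar int :=
  supremum -oo%E [set x | exists d (s : rsimplex RR X d),
    range s `&` sset S !=set0 /\ x = blowup_norm (codim S) (w d s)].

Definition allowable X (p : perversity X) (w : family X) : Prop :=
  forall S : stratum X, singular_stratum S -> (stratum_norm w S <= p S)%E.

Definition intersection_cochain X (p : perversity X) k (w : family X) : Prop :=
  [/\ blowup_cochain k w, allowable p w & allowable p (family_delta w)].

Lemma allowableP X (p : perversity X) (w : family X) :
  allowable p w <->
  forall (S : stratum X) d (s : rsimplex RR X d) a, singular_stratum S ->
    range s `&` sset S !=set0 -> w d s a != 0 ->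
    (cell_norm (codim S) a <= p S)%E.
Proof.
split=> [H S d s a Ss sS wa|H S Ss].
  have /ereal_int_supremum_le K := H S Ss.
  have /blowup_norm_le := K (blowup_norm (codim S) (w d s)) ltac:(by exists d, s).
  exact.
apply/ereal_int_supremum_le => _ [d [s [sS ->]]].
by apply/blowup_norm_le => a wa; exact: (H S d s).
Qed.

Lemma family_delta_is_linear X : linear (@family_delta X).
Proof. by move=> k w w'; apply: familyP => d s; exact: linearP. Qed.

HB.instance Definition _ X :=
  GRing.isLinear.Build R _ _ _ _ (@family_delta_is_linear X).

Lemma allowable_lin X (p : perversity X) k (w w' : family X) :
  allowable p w -> allowable p w' -> allowable p (k *: w + w').
Proof.
move=> /allowableP H /allowableP H'; apply/allowableP => S d s a Ss sS.
have [w0|w0 _] := eqVneq (w d s a) 0; last exact: H w0.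
have [w'0|w'0 _] := eqVneq (w' d s a) 0; last exact: H' w'0.
have -> : (k *: w + w') d s a = k * w d s a + w' d s a by rewrite !ffunE.
by rewrite w0 w'0 mulr0 addr0 eqxx.
Qed.

Lemma allowable0 X (p : perversity X) : allowable p 0.
Proof. by apply/allowableP => S d s a _ _; rewrite ffunE eqxx. Qed.

Lemma blowup_cochain_lin X k c (w w' : family X) :
  blowup_cochain k w -> blowup_cochain k w' -> blowup_cochain k (c *: w + w').
Proof.
move=> [D F] [D' F']; split.
  move=> d s a.
  have [w0|w0 _] := eqVneq (w d s a) 0; last exact: D w0.
  have [w'0|w'0 _] := eqVneq (w' d s a) 0; last exact: D' w'0.
  have -> : (c *: w + w') d s a = c * w d s a + w' d s a by rewrite !ffunE.
  by rewrite w0 w'0 mulr0 addr0 eqxx.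
move=> d l s r; rewrite -[RHS]/(c *: w d _ + w' d _) -F -F'.
exact: linearP.
Qed.

Lemma blowup_cochain0 X k : blowup_cochain k (0 : family X).
Proof.
split=> [d s a|d l s r]; first by rewrite ffunE eqxx.
exact: linear0.
Qed.

Lemma intersection_cochain_lin X (p : perversity X) k c (w w' : family X) :
  intersection_cochain p k w -> intersection_cochain p k w' ->
  intersection_cochain p k (c *: w + w').
Proof.
move=> [D A B] [D' A' B']; split; first exact: blowup_cochain_lin.
- exact: allowable_lin.
- by rewrite linearP; exact: allowable_lin.
Qed.

Lemma intersection_cochain0 X (p : perversity X) k :
  intersection_cochain p k 0.
Proof.
split; [exact: blowup_cochain0|exact: allowable0|].
by rewrite linear0; exact: allowable0.
Qed.

Lemma subsemimod_closed_lin (V : lmodType R) (P : {pred V}) :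
  0 \in P -> (forall c u v, u \in P -> v \in P -> c *: u + v \in P) ->
  GRing.subsemimod_closed P.
Proof.
move=> P0 Pl; split; first split=> // u v uP vP.
  by rewrite -[u]scale1r Pl.
by move=> c u uP; rewrite -[_ *: _]addr0 Pl.
Qed.

Section Cohomology.
Variables (X : filteredSpace n) (p : perversity X) (k : nat).

Definition is_cocycle : {pred family X} :=
  fun w => `[< intersection_cochain p k w /\ family_delta w = 0 >].

Let is_cocycle_closed : GRing.subsemimod_closed is_cocycle.
Proof.
apply: subsemimod_closed_lin.
  apply/asboolP; split; [exact: intersection_cochain0|exact: linear0].
move=> c u v /asboolP[uN u0] /asboolP[vN v0]; apply/asboolP; split.
  exact: intersection_cochain_lin.
by rewrite linearP /= u0 v0 scaler0 addr0.
Qed.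

HB.instance Definition _ :=
  GRing.isSubmodClosed.Build R (family X) is_cocycle is_cocycle_closed.

Record cocycle := Cocycle { coval :> family X; coval_in : coval \in is_cocycle }.

HB.instance Definition _ := [isSub for coval].
HB.instance Definition _ := [Choice of cocycle by <:].
HB.instance Definition _ := [SubChoice_isSubLmodule of cocycle by <:].

Definition is_coboundary : {pred cocycle} := fun z =>
  `[< if k is j.+1 then
        exists2 w : family X, intersection_cochain p j w &
          family_delta w = coval z
      else z = 0 >].

Let is_coboundary_closed : GRing.subsemimod_closed is_coboundary.
Proof.
rewrite /is_coboundary; apply: subsemimod_closed_lin.
  apply/asboolP; case: (k) => // j.
  by exists 0; [exact: intersection_cochain0|exact: linear0].
move=> c u v /asboolP + /asboolP + ; rewrite !unfold_in.
case: (k) => [-> ->|j [w wN wu] [w' wN' wv]].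
  by apply/asboolP; rewrite scaler0 addr0.
apply/asboolP; exists (c *: w + w'); first exact: intersection_cochain_lin.
by rewrite linearP /= wu wv.
Qed.

HB.instance Definition _ :=
  GRing.isSubmodClosed.Build R cocycle is_coboundary is_coboundary_closed.

Definition cohomology : Type := Quotient.quot is_coboundary.

HB.instance Definition _ := GRing.Zmodule.on cohomology.
HB.instance Definition _ := EqQuotient.on cohomology.

Definition coclass (z : cocycle) : cohomology := (\pi_cohomology z)%qT.

Lemma coclass_eq (z z' : cocycle) :
  coclass z = coclass z' <-> z - z' \in is_coboundary.
Proof.
rewrite (Quotient.idealrBE is_coboundary z z'); split=> [/eqP //|/eqP //].
Qed.

Lemma coclassD (z z' : cocycle) : coclass (z + z') = coclass z + coclass z'.
Proof. by rewrite /coclass; exact: (raddfD (\pi_(Quotient.quot is_coboundary))%qT). Qed.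

Lemma coclass_repr (c : cohomology) : coclass (repr c) = c.
Proof. exact: reprK. Qed.

Let scaleq (a : R) (c : cohomology) : cohomology := coclass (a *: repr c).

Let coclassZ_ a (z : cocycle) : scaleq a (coclass z) = coclass (a *: z).
Proof.
apply/coclass_eq; rewrite -scalerBr; apply: rpredZ.
by apply/coclass_eq; rewrite coclass_repr.
Qed.

Let scaleqA a b c : scaleq a (scaleq b c) = scaleq (a * b) c.
Proof. by rewrite -(coclass_repr c) !coclassZ_ scalerA. Qed.
Let scale1q : left_id 1 scaleq.
Proof. by move=> c; rewrite -{2}(coclass_repr c) /scaleq scale1r. Qed.
Let scaleqDr : right_distributive scaleq +%R.
Proof.
move=> a c c'; rewrite -(coclass_repr c) -(coclass_repr c').
by rewrite -coclassD !coclassZ_ scalerDr coclassD.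
Qed.
Let scaleqDl c : {morph scaleq^~ c : a b / a + b}.
Proof. by move=> a b; rewrite /scaleq scalerDl coclassD. Qed.

HB.instance Definition _ :=
  GRing.Zmodule_isLmodule.Build R cohomology scaleqA scale1q scaleqDr scaleqDl.

Lemma coclassZ a (z : cocycle) : coclass (a *: z) = a *: coclass z.
Proof. by rewrite -coclassZ_. Qed.

End Cohomology.
Arguments is_cocycle {X} p k _.
Arguments is_coboundary {X} p k _.

(* The last field makes pullback preserve allowability. *)
Record perverse_map X (p : perversity X) Y (q : perversity Y) := PerverseMap {
  pvmap :> X -> Y;
  pvmap_continuous : continuous pvmap;
  pvmap_skel : forall i, pvmap @^-1` skel Y i = skel X i;
  pvmap_perversity : forall (S : stratum X) (T : stratum Y),
    (pvmap @` sset S) `&` sset T !=set0 -> (q T <= p S)%E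
}.

Lemma pvmap_layer X (p : perversity X) Y (q : perversity Y)
  (f : perverse_map p q) i x : layer Y i (f x) <-> layer X i x.
Proof.
have H j : skel Y j (f x) = skel X j x by rewrite -(pvmap_skel f j).
by rewrite /layer /= H; case: i => //= i; rewrite H.
Qed.

Section Composition.
Variables (X Y Z : filteredSpace n).
Variables (p : perversity X) (q : perversity Y) (r : perversity Z).
Variables (g : perverse_map q r) (f : perverse_map p q).

Let gf_continuous : continuous (g \o f).
Proof.
by move=> x; apply: continuous_comp; [exact: pvmap_continuous|exact: pvmap_continuous].
Qed.

Let gf_skel i : (g \o f) @^-1` skel Z i = skel X i.
Proof. by rewrite -(pvmap_skel f) -(pvmap_skel g). Qed.

Let gf_perversity (S : stratum X) (T : stratum Z) :
  ((g \o f) @` sset S) `&` sset T !=set0 -> (r T <= p S)%E.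
Proof.
move=> [_ [[x Sx <-] Tx]]; have [i fxi] := layer_ex (f x).
apply: (@le_trans _ _ (q (stratum_of fxi))).
  apply: (@pvmap_perversity _ _ _ _ g); exists (g (f x)); split => //.
  by exists (f x) => //; exact: stratum_ofP.
apply: (@pvmap_perversity _ _ _ _ f); exists (f x); split; first by exists x.
exact: stratum_ofP.
Qed.

Definition pvmap_comp : perverse_map p r :=
  PerverseMap gf_continuous gf_skel gf_perversity.

End Composition.

Section Induced.
Variables (X Y : filteredSpace n) (p : perversity X) (q : perversity Y).
Variable f : perverse_map p q.

Section Postcomposition.
Variables (d : nat) (s : fsimplex RR X d).

Let fs_continuous : continuous (f \o s).
Proof.
by move=> t; apply: continuous_comp; [exact: smap_continuous|exact: pvmap_continuous].
Qed.

Let fs_filtered (i : nat) (t : Delta RR d) : skel Y i ((f \o s) t) <->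
  (forall v, (i < part s v)%N -> set_val t ord0 v = 0).
Proof.
rewrite -(smap_filtered s) -(pvmap_skel f); split; exact: id.
Qed.

Definition fsimplex_comp : fsimplex RR Y d :=
  FSimplex fs_continuous (@part_mono _ _ _ _ s) fs_filtered.
End Postcomposition.

Definition rsimplex_comp d (s : rsimplex RR X d) : rsimplex RR Y d :=
  @RSimplex _ _ _ _ (fsimplex_comp s) (rsimplex_regular s).

Definition pullback (w : family Y) : family X :=
  fun d s => w d (rsimplex_comp s).

Lemma pullback_is_linear : linear pullback.
Proof. by []. Qed.

HB.instance Definition _ :=
  GRing.isLinear.Build R _ _ _ _ pullback_is_linear.

Lemma pullback_delta w : pullback (family_delta w) = family_delta (pullback w).
Proof. by []. Qed.

Lemma pullback_cochain k w :
  blowup_cochain k w -> blowup_cochain k (pullback w).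
Proof.
move=> [D F]; split=> [d s a|d l s r]; first exact: D.
rewrite -[LHS]/(blowup_face l (w d.+1 (rsimplex_comp s))).
have r' : regular (face l (rsimplex_comp s)) by exact: r.
by rewrite (F d l (rsimplex_comp s) r'); exact: family_eq.
Qed.

Lemma pvmap_codim (S : stratum X) (T : stratum Y) x :
  sset S x -> sset T (f x) -> codim S = codim T.
Proof.
move=> /stratum_layer Sx /stratum_layer /pvmap_layer Tx.
by rewrite /codim (layer_inj Sx Tx).
Qed.

Lemma pullback_allowable w : allowable q w -> allowable p (pullback w).
Proof.
move=> /allowableP H; apply/allowableP => S d s a Ss [x [[t _ tx] Sx]] wa.
have [i fxi] := layer_ex (f x).
pose T := stratum_of fxi; have Tfx : sset T (f x) := stratum_ofP fxi.
have cST := pvmap_codim Sx Tfx.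
apply: (@le_trans _ _ (q T)); last first.
  by apply: (@pvmap_perversity _ _ _ _ f); exists (f x); split => //; exists x.
rewrite cST; apply: (H T d (rsimplex_comp s)) => //.
- by move=> T0; apply: Ss; rewrite /regular_stratum cST.
- by exists (f x); split => //; exists t => //=; rewrite tx.
Qed.

Lemma pullback_intersection_cochain k w :
  intersection_cochain q k w -> intersection_cochain p k (pullback w).
Proof.
move=> [Nw Aw Adw]; split; first exact: pullback_cochain.
- exact: pullback_allowable.
- by rewrite -pullback_delta; exact: pullback_allowable.
Qed.

Lemma pullback_cocycle_subproof k (z : cocycle q k) :
  pullback z \in is_cocycle p k.
Proof.
have /asboolP[zN z0] := coval_in z; apply/asboolP; split.
  exact: pullback_intersection_cochain.
by rewrite -pullback_delta z0 linear0.
Qed.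

Definition pullback_cocycle k (z : cocycle q k) : cocycle p k :=
  Cocycle (pullback_cocycle_subproof z).

Lemma pullback_cocycleB k (z z' : cocycle q k) :
  pullback_cocycle (z - z') = pullback_cocycle z - pullback_cocycle z'.
Proof. exact: val_inj. Qed.

Lemma pullback_coboundary k (z : cocycle q k) :
  z \in is_coboundary q k -> pullback_cocycle z \in is_coboundary p k.
Proof.
move=> /asboolP H; apply/asboolP; case: k z H => [|j] z.
  by move=> ->; exact: val_inj.
move=> [w wN wz]; exists (pullback w); first exact: pullback_intersection_cochain.
by rewrite -pullback_delta wz.
Qed.

Definition cohomology_map k (c : cohomology q k) : cohomology p k :=
  coclass (pullback_cocycle (repr c)).

Lemma cohomology_map_coclass k (z : cocycle q k) :
  cohomology_map (coclass z) = coclass (pullback_cocycle z).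
Proof.
apply/coclass_eq; rewrite -pullback_cocycleB; apply: pullback_coboundary.
by apply/coclass_eq; rewrite coclass_repr.
Qed.

Lemma cohomology_map_is_linear k : linear (@cohomology_map k).
Proof.
move=> a c c'; rewrite -(coclass_repr c) -(coclass_repr c').
rewrite -coclassZ -coclassD !cohomology_map_coclass -coclassZ -coclassD.
by congr coclass; exact: val_inj.
Qed.

HB.instance Definition _ k :=
  GRing.isLinear.Build R _ _ _ _ (@cohomology_map_is_linear k).

End Induced.

Section ProductMaps.
Variables (X : filteredSpace n) (p : perversity (prodR RR X)).
Let q : perversity X := perversity_restrict p.

Let pr_skel i : fst @^-1` skel X i = skel (prodR RR X) i.
Proof. by apply/seteqP; split=> [[x t]|[x t] []]. Qed.

Let pr_perversity (S : stratum (prodR RR X)) (T : stratum X) :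
  (fst @` sset S) `&` sset T !=set0 -> (q T <= p S)%E.
Proof.
move=> [_ [[[x t] Sxt <-] /= Tx]].
by rewrite (@stratum_meet _ _ S (stratum_prodR RR T) (x, t)).
Qed.

Definition pr_map : perverse_map p q :=
  PerverseMap (@pr_continuous RR n X) pr_skel pr_perversity.

Variable t : RR.

Let inj_skel i : (fun x : X => (x, t)) @^-1` skel (prodR RR X) i = skel X i.
Proof. by apply/seteqP; split=> [x []|x]. Qed.

Let inj_perversity (S : stratum X) (T : stratum (prodR RR X)) :
  ((fun x : X => (x, t)) @` sset S) `&` sset T !=set0 -> (p T <= q S)%E.
Proof.
move=> [_ [[x Sx <-] Txt]].
by rewrite (@stratum_meet _ _ T (stratum_prodR RR S) (x, t)).
Qed.

Definition slice_map : perverse_map q p :=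
  PerverseMap (@inj_continuous RR n X t) inj_skel inj_perversity.

End ProductMaps.
End Cochains.
Arguments cohomology RR R {n X} p k.
Arguments cohomology_map RR R {n X Y p q} f k c.

(* Main.v *)
Require Import Defs.
From mathcomp Require Import all_boot all_order all_algebra.
From mathcomp Require Import all_classical all_reals all_analysis.
From mathcomp Require Import zify ring.
Import Order.TTheory GRing.Theory Num.Theory.
Import numFieldNormedType.Exports.
Local Open Scope ring_scope.

Set Implicit Arguments.
Unset Strict Implicit.
Unset Printing Implicit Defensive.

(** Fix a height r and let f be the map (x, y) |-> (x, r) of X x R to itself; for
    r = 0 and r = 1 it is the composite of the projection with an injection. The
    theorem says that f^* is the identity on cohomology, for each r
    ([cohomology_map_retraction]).

    The straight-line homotopy from the identity to f moves the second coordinate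
    only, so it never leaves a stratum S x R. Composing it with a simplex s with
    vertices 0, ..., d gives a map on the prism Delta x [0, 1], which is cut as
    usual into the (d+1)-simplices with vertices
    (0,0), ..., (j,0), (j,1), ..., (d,1): these are the [prism j s]. The operator
    [prism_op] sends a cochain w to
      (T w)_s (a) = sum over the vertices j of a of +- w_(prism j s) (s_j^* a),
    where s_j^* a is the cell a with its vertex j doubled, that is the preimage
    of a under the j-th degeneracy.

    The blow-up is a tensor product over the factors of the join, and the
    homotopy of a tensor product is a sum, over a factor i, of terms with the
    bottom of the prism in the factors before i, the prism operator in the
    factor i, and the top of the prism in the factors after i. The vertices are
    ordered compatibly with the join, so when the factor i is split at its
    vertex j all these faces lie in the one simplex [prism j s] and form the
    cell s_j^* a. This is why a formula with no reference to the factors is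
    the right one.

    Then delta T + T delta = id - f^* ([homotopy_identity]). Deleting a vertex or
    an apex and doubling another vertex j anticommute, so these terms cancel.
    The remaining ones delete one of the two copies of j; they are the values of
    w on the simplices [tilt j s] and [tilt j.+1 s], where [tilt m s] is s with
    its vertices v >= m moved to height r, and they telescope from [tilt d.+1 s],
    which is s, to [tilt 0 s], which is f o s.

    T preserves allowability ([prism_op_allowable]): doubling a vertex does not
    lower the dimension of any factor and does not touch the apexes, and
    [prism j s] meets every stratum that s meets. For a cocycle w the cochain
    delta (T w) = w - f^* w is allowable too, hence T w is an intersection
    cochain that bounds w - f^* w.

    The type of the cells of a simplex depends on its join decomposition, while
    the decompositions of faces of prisms agree only up to extensionality. All
    computations are therefore made with [value], which extends each w_s by zero
    to a type of cells that depends only on the dimension. *)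

(** * Continuity of maps into simplices *)

Lemma continuous_row (RR : realType) (T : topologicalType) m (f : T -> 'rV[RR]_m) :
  (forall v, continuous (fun t => f t ord0 v)) -> continuous f.
Proof.
move=> cf t A [P fP PA]; apply: filterS PA _ => /=.
have : \forall u \near t, forall v, P ord0 v (f u ord0 v).
  by apply: filter_forall => v; apply: (cf v t); exact: fP.
by apply: filterS => u Pu i v; rewrite (ord1 i).
Qed.

Lemma continuous_sum (RR : realType) (T : topologicalType) (I : Type) (r : seq I)
    (P : pred I) (f : I -> T -> RR) :
  (forall i, continuous (f i)) -> continuous (fun t => \sum_(i <- r | P i) f i t).
Proof.
move=> cf; apply: continuous_big => [|i _]; last exact: cf.
exact: add_continuous.
Qed.

Lemma continuous_interpolation (RR : realType) (T : topologicalType) (r : RR)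
    (f g : T -> RR) : continuous f -> continuous g ->
  continuous (fun t => (1 - f t) * g t + f t * r).
Proof.
move=> cf cg t; apply: cvgD; apply: cvgM; last exact: cvg_cst.
- by apply: cvgB; [exact: cvg_cst|exact: cf].
- exact: cg.
- exact: cf.
Qed.

(** * Affine maps of simplices *)

Section Pushforward.
Variable RR : realType.

Lemma coord_Delta_continuous d v : continuous (fun t : Delta RR d => set_val t ord0 v).
Proof.
move=> t; apply: (@continuous_comp _ _ _ set_val (fun M : 'rV[RR]_d.+1 => M ord0 v)).
  exact: initial_continuous.
exact: coord_continuous.
Qed.

Definition push_row m d (phi : 'I_m.+1 -> 'I_d.+1) (t : 'rV[RR]_m.+1) : 'rV[RR]_d.+1 :=
  \row_v \sum_(u | phi u == v) t ord0 u.

Lemma push_row_Delta m d (phi : 'I_m.+1 -> 'I_d.+1) (t : Delta RR m) :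
  push_row phi (set_val t) \in Delta RR d.
Proof.
have [/= t0 t1] := set_mem (valP t).
rewrite inE; split=> [v|]; first by rewrite mxE sumr_ge0.
rewrite -[RHS]t1 (partition_big phi predT) //=.
by apply: eq_bigr => v _; rewrite mxE.
Qed.

Definition push m d (phi : 'I_m.+1 -> 'I_d.+1) (t : Delta RR m) : Delta RR d :=
  exist _ (push_row phi (set_val t)) (push_row_Delta phi t).

Lemma push_continuous m d (phi : 'I_m.+1 -> 'I_d.+1) : continuous (push phi).
Proof.
apply: continuous_comp_initial; apply: continuous_row => v.
rewrite (_ : (fun _ => _) =
  (fun t : Delta RR m => \sum_(u | phi u == v) set_val t ord0 u)).
  by apply: continuous_sum => u; exact: coord_Delta_continuous.
by apply/funext => t; rewrite /= mxE.
Qed.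

Lemma Delta_eq d (t t' : Delta RR d) :
  (forall v, set_val t ord0 v = set_val t' ord0 v) -> t = t'.
Proof. by move=> tt'; apply: val_inj; apply/rowP => v; exact: tt'. Qed.

Lemma push_id d (t : Delta RR d) : push id t = t.
Proof. by apply: Delta_eq => v; rewrite mxE big_pred1_eq. Qed.

Lemma push_face m d (phi : 'I_m.+2 -> 'I_d.+1) l (t : Delta RR m) :
  push phi (face_map l t) = push (phi \o lift l) t.
Proof.
apply: Delta_eq => v; rewrite !mxE big_mkcond (bigD1_ord l) //= face_row_self if_same.
rewrite add0r [RHS]big_mkcond /=.
by apply: eq_bigr => u _; rewrite face_row_lift.
Qed.

Lemma face_map_push d l (t : Delta RR d) : face_map l t = push (lift l) t.
Proof. by rewrite -(push_id (face_map l t)) push_face. Qed.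

Lemma push_comp m e d (phi : 'I_e.+1 -> 'I_d.+1) (psi : 'I_m.+1 -> 'I_e.+1)
  (t : Delta RR m) : push phi (push psi t) = push (phi \o psi) t.
Proof.
apply: Delta_eq => v; rewrite !mxE (partition_big psi (fun u => phi u == v)) //=.
apply: eq_bigr => u /eqP uv; rewrite mxE; apply: eq_bigl => w /=.
by case: (eqVneq (psi w) u) => [->|]; rewrite ?andbF // uv eqxx.
Qed.

(** Nonnegative coordinates cannot cancel in the sum over a fibre. *)
Lemma push_coord0 m d (phi : 'I_m.+1 -> 'I_d.+1) (t : Delta RR m) v :
  set_val (push phi t) ord0 v = 0 <-> forall u, phi u = v -> set_val t ord0 u = 0.
Proof.
have [/= t0 _] := set_mem (valP t); rewrite mxE; split=> [s0 u uv|H].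
  by apply: (psumr_eq0P _ s0) => [i _|]; [exact: t0|apply/eqP].
by apply: big1 => u /eqP; exact: H.
Qed.

(** The height function on the simplex which is affine, 1 on the vertices in h
    and 0 on the others. *)
Definition height m (h : pred 'I_m.+1) (t : Delta RR m) : RR :=
  \sum_(v | h v) set_val t ord0 v.

Lemma height_continuous m (h : pred 'I_m.+1) : continuous (height h).
Proof. by apply: continuous_sum => v; exact: coord_Delta_continuous. Qed.

Lemma height_face m (h : pred 'I_m.+2) l (t : Delta RR m) :
  height h (face_map l t) = height (h \o lift l) t.
Proof.
rewrite /height big_mkcond (bigD1_ord l) //= face_row_self if_same add0r.
rewrite [RHS]big_mkcond /=.
by apply: eq_bigr => u _; rewrite face_row_lift.
Qed.

Lemma height0 m (t : Delta RR m) : height pred0 t = 0.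
Proof. by rewrite /height big_pred0. Qed.

Lemma height1 m (t : Delta RR m) : height predT t = 1.
Proof. by have [] := set_mem (valP t). Qed.

End Pushforward.

(** * The straight-line homotopy towards a slice *)

Definition nondec m d (phi : 'I_m.+1 -> 'I_d.+1) : Prop :=
  forall u v : 'I_m.+1, (u <= v)%N -> (phi u <= phi v)%N.

Lemma nondec_id d : nondec (@id 'I_d.+1).
Proof. by []. Qed.

Lemma nondec_lift d (l : 'I_d.+2) : nondec (lift l).
Proof. by move=> u v; rewrite /= leq_bump2. Qed.

Lemma nondec_comp m e d (phi : 'I_e.+1 -> 'I_d.+1) (psi : 'I_m.+1 -> 'I_e.+1) :
  nondec phi -> nondec psi -> nondec (phi \o psi).
Proof. by move=> mphi mpsi u v uv; apply: mphi; exact: mpsi. Qed.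

Lemma fsimplex_eq (RR : realType) n (X : filteredSpace n) d (s s' : fsimplex RR X d) :
  smap s =1 smap s' -> part s =1 part s' -> s = s'.
Proof.
case: s => f q cf mq fq; case: s' => f' q' cf' mq' fq' /= /funext ef /funext eq.
subst f' q'.
by rewrite (Prop_irrelevance cf cf') (Prop_irrelevance mq mq') (Prop_irrelevance fq fq').
Qed.

(** All simplices of the homotopy have one form: precompose s with the affine map
    given by phi on the vertices, then move the vertices in h to height r. Faces
    of such a simplex, and such simplices of a face, are again of this form, so
    that identities between iterated faces of prisms reduce to identities between
    vertex maps. *)
Section Sweep.
Variables (RR : realType) (n : nat) (X : filteredSpace n) (r : RR).
Notation Y := (prodR RR X).

Section Def.
Variables (m d : nat) (phi : 'I_m.+1 -> 'I_d.+1) (h : pred 'I_m.+1) (s : fsimplex RR Y d).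
Hypothesis mphi : nondec phi.

Let map (t : Delta RR m) : Y :=
  let z := s (push phi t) in
  (z.1, (1 - height h t) * z.2 + height h t * r).

Let map_continuous : continuous map.
Proof.
have cz : continuous (fun t => s (push phi t)).
  move=> t; apply: (@continuous_comp _ _ _ (push phi) s).
    exact: push_continuous.
  exact: smap_continuous.
have cz1 : continuous (fun t => (s (push phi t)).1).
  move=> t; apply: (@continuous_comp _ _ _ (fun t => s (push phi t)) fst).
    exact: cz.
  exact: pr_continuous.
have cz2 : continuous (fun t => (s (push phi t)).2).
  move=> t; apply: (@continuous_comp _ _ _ (fun t => s (push phi t)) snd).
    exact: cz.
  by case: (s _) => x y; exact: (@cvg_snd _ _ (nbhs x) (nbhs y)).
have ch := @height_continuous RR m h.
have c2 : continuous (fun t => (1 - height h t) * (s (push phi t)).2 + height h t * r).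
  exact: (@continuous_interpolation RR _ r (height h)
            (fun t => (s (push phi t)).2) ch cz2).
move=> t; exact: (cvg_pair (cz1 t) (c2 t)).
Qed.

Let map_filtered (i : nat) (t : Delta RR m) : skel Y i (map t) <->
  (forall v, (i < part s (phi v))%N -> set_val t ord0 v = 0).
Proof.
rewrite (_ : skel Y i (map t) = skel Y i (s (push phi t))) //.
rewrite (smap_filtered s); split=> [H v iv|H v iv].
  exact: ((push_coord0 phi t (phi v)).1 (H _ iv)).
by apply/push_coord0 => u uv; apply: H; rewrite uv.
Qed.

Definition sweep : fsimplex RR Y m :=
  @FSimplex RR n Y m map (part s \o phi) map_continuous
    (fun u v uv => part_mono s (mphi uv)) map_filtered.

End Def.

Lemma sweep_eq m d (phi psi : 'I_m.+1 -> 'I_d.+1) (h k : pred 'I_m.+1)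
    (s : fsimplex RR Y d) (mphi : nondec phi) (mpsi : nondec psi) :
  phi =1 psi -> h =1 k -> sweep h s mphi = sweep k s mpsi.
Proof.
move=> /funext ephi /funext eh; subst psi k.
by rewrite (Prop_irrelevance mphi mpsi).
Qed.

Lemma face_sweep m d l (phi : 'I_m.+2 -> 'I_d.+1) h (s : fsimplex RR Y d)
    (mphi : nondec phi) :
  face l (sweep h s mphi) = sweep (h \o lift l) s (nondec_comp mphi (@nondec_lift _ l)).
Proof.
by apply: fsimplex_eq => //= t; rewrite push_face height_face.
Qed.

Lemma sweep_face m d l (phi : 'I_m.+1 -> 'I_d.+1) h (s : fsimplex RR Y d.+1)
    (mphi : nondec phi) :
  sweep h (face l s) mphi = sweep h s (nondec_comp (@nondec_lift _ l) mphi).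
Proof.
by apply: fsimplex_eq => //= t; rewrite face_map_push push_comp.
Qed.

Lemma sweep0 d (s : fsimplex RR Y d) : sweep pred0 s (@nondec_id d) = s.
Proof.
apply: fsimplex_eq => //= t; rewrite push_id height0 subr0 mul1r mul0r addr0.
by case: (s t).
Qed.

Lemma sweep1 (p : perversity Y) d (s : fsimplex RR Y d) :
  sweep predT s (@nondec_id d) = fsimplex_comp (pvmap_comp (slice_map p r) (pr_map p)) s.
Proof.
by apply: fsimplex_eq => //= t; rewrite push_id height1 subrr mul0r mul1r add0r.
Qed.

End Sweep.

(** * Cells of the blow-up, independently of the join decomposition *)

Section RawCells.
Variable n : nat.

(** The indices of the basis of a blow-up, together with junk: only those that
    satisfy [is_cell part] are cells for the decomposition [part]. *)
Definition rawcell d : Type := {ffun 'I_n.+1 -> cface d}.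

Definition preim_cell d m (phi : 'I_m.+1 -> 'I_d.+1) (b : rawcell d) : rawcell m :=
  [ffun i => (phi @^-1: (b i).1, (b i).2)]%SET.

Definition del_vertex d (b : rawcell d) (w : 'I_d.+1) : rawcell d :=
  [ffun i => ((b i).1 :\ w, (b i).2)]%SET.

Definition del_apex d (b : rawcell d) (i : 'I_n.+1) : rawcell d :=
  [ffun k => ((b k).1, (b k).2 && (k != i))].

(** Two more than the dimension of the i-th factor of a cell: the shift avoids the
    truncation of [cdim] at 0 and does not change signs. *)
Definition cdim2 d (b : rawcell d) (i : 'I_n.+1) : nat := (#|(b i).1| + (b i).2).+1.

Definition count_below m (F : {set 'I_m.+1}) (x : nat) : nat :=
  #|[pred u in F | (u < x)%N]|.

(** The sign with which the face opposite to the vertex w occurs in the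
    differential is (-1)^(vertex_exp part b w), where b is the larger cell; the
    sign of the face opposite to the apex of the i-th factor is
    (-1)^(apex_exp b i). *)
Definition vertex_exp d (part : 'I_d.+1 -> 'I_n.+1) (b : rawcell d) (w : 'I_d.+1) : nat :=
  (\sum_(k < n.+1 | (k <= part w)%N) cdim2 b k + count_below (b (part w)).1 w)%N.

Definition apex_exp d (b : rawcell d) (i : 'I_n.+1) : nat :=
  (\sum_(k < n.+1 | (k < i)%N) cdim2 b k)%N.

Lemma is_cellP d (part : 'I_d.+1 -> 'I_n.+1) (b : rawcell d) : reflect
  [/\ forall i v, v \in (b i).1 -> part v = i,
      forall i, (0 < #|(b i).1| + (b i).2)%N & (b ord_max).2 = false]
  (is_cell part b).
Proof.
apply: (iffP andP) => [[/forallP H /negbTE M]|[H0 H1 H2]].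
  split=> // i; last by have /andP[] := H i.
  by move=> v vi; have /andP[/forallP/(_ v)/implyP/(_ vi)/eqP] := H i.
split; last by rewrite H2.
apply/forallP => i; rewrite H1 andbT; apply/forallP => v.
by apply/implyP => /H0 ->.
Qed.

Section Ops.
Variables (d : nat).
Implicit Types (b : rawcell d) (part : 'I_d.+1 -> 'I_n.+1).

Lemma cell_disjoint part b i j w : is_cell part b -> w \in (b i).1 ->
  (w \in (b j).1) = (j == i).
Proof.
move=> /is_cellP[b0 _ _] wi; apply/idP/eqP => [wj|->//].
by rewrite -(b0 _ _ wi) (b0 _ _ wj).
Qed.

Lemma cdim2_del_vertex part b i w j : is_cell part b -> w \in (b i).1 ->
  cdim2 b j = (cdim2 (del_vertex b w) j + (j == i))%N.
Proof.
move=> bc wi; rewrite /cdim2 ffunE /= (finset.cardsD1 w (b j).1) (cell_disjoint j bc wi).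
by rewrite addSn -addnA addnC.
Qed.

Lemma cdim2_del_apex b i j : (b i).2 -> cdim2 b j = (cdim2 (del_apex b i) j + (j == i))%N.
Proof.
by move=> bi; rewrite /cdim2 ffunE /=; case: eqVneq => [->|_]; rewrite ?bi ?andbT /=; lia.
Qed.

Lemma preim_cell_comp m e (phi : 'I_e.+1 -> 'I_d.+1) (psi : 'I_m.+1 -> 'I_e.+1) b :
  preim_cell psi (preim_cell phi b) = preim_cell (phi \o psi) b.
Proof.
by apply/ffunP => i; rewrite !ffunE; congr pair; apply/setP => u; rewrite !inE.
Qed.

Lemma preim_cell_del_apex m (phi : 'I_m.+1 -> 'I_d.+1) b i :
  preim_cell phi (del_apex b i) = del_apex (preim_cell phi b) i.
Proof. by apply/ffunP => k; rewrite !ffunE. Qed.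

Lemma preim_cell_del_vertex m (phi : 'I_m.+1 -> 'I_d.+1) b w w' :
  (forall u, (phi u == w) = (u == w')) ->
  preim_cell phi (del_vertex b w) = del_vertex (preim_cell phi b) w'.
Proof.
move=> H; apply/ffunP => k; rewrite !ffunE /=; congr pair.
by apply/setP => u; rewrite !inE H.
Qed.

Lemma is_cell_preim m (phi : 'I_m.+1 -> 'I_d.+1) part b :
  (forall i v, v \in (b i).1 -> exists u, phi u = v) ->
  is_cell (part \o phi) (preim_cell phi b) = is_cell part b.
Proof.
move=> surj; apply/idP/idP => /is_cellP[H0 H1 H2]; apply/is_cellP; split.
- move=> i v vi; have [u uv] := surj i v vi.
  by rewrite -uv; apply: H0; rewrite ffunE inE uv.
- move=> i; have := H1 i; rewrite ffunE /=.
  rewrite !addn_gt0 => /orP[/card_gt0P[u]|->]; last by rewrite orbT.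
  by rewrite inE => ub; apply/orP; left; apply/card_gt0P; exists (phi u).
- by have := H2; rewrite ffunE.
- by move=> i u; rewrite ffunE inE => /H0.
- move=> i; have := H1 i; rewrite ffunE /= !addn_gt0 => /orP[/card_gt0P[v vb]|->].
    have [u uv] := surj i v vb; apply/orP; left; apply/card_gt0P; exists u.
    by rewrite inE uv.
  by rewrite orbT.
- by rewrite ffunE.
Qed.

End Ops.
End RawCells.

(** * The differential in coordinates *)

Section Values.
Variables (R : comPzRingType) (n : nat).

Definition raw_coef d (part : 'I_d.+1 -> 'I_n.+1) (c : blowup R part)
    (b : rawcell n d) : R :=
  \sum_(a : cell part | val a == b) c a.

Lemma raw_coef_val d (part : 'I_d.+1 -> 'I_n.+1) (c : blowup R part) (a : cell part) :
  raw_coef c (val a) = c a.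
Proof. by rewrite /raw_coef (big_pred1 a) // => a'; rewrite /= val_eqE. Qed.

Lemma raw_coef_notcell d (part : 'I_d.+1 -> 'I_n.+1) (c : blowup R part) b :
  ~~ is_cell part b -> raw_coef c b = 0.
Proof.
move=> nb; rewrite /raw_coef big_pred0 // => a.
by apply: contraNF nb => /eqP <-; exact: valP.
Qed.

Lemma raw_coef_sum d (part : 'I_d.+1 -> 'I_n.+1) (c : blowup R part) b (x : R) :
  \sum_(a : cell part) (x *+ (val a == b)) * c a = x * raw_coef c b.
Proof.
rewrite /raw_coef mulr_sumr [RHS]big_mkcond /=; apply: eq_bigr => a _.
by case: eqP; rewrite ?mulr1n // mulr0n mul0r.
Qed.

Lemma eq_sign i j : odd i = odd j -> (-1) ^+ i = (-1) ^+ j :> R.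
Proof. by move=> ij; rewrite -signr_odd ij signr_odd. Qed.

Lemma sign_neq i j : odd i = ~~ odd j -> (-1) ^+ i = - (-1) ^+ j :> R.
Proof. by move=> ij; rewrite -signr_odd ij signrN signr_odd. Qed.

Lemma cdim2E d (b : rawcell n d) i : (0 < #|(b i).1| + (b i).2)%N ->
  (cdim (b i)).+2 = cdim2 b i.
Proof. by rewrite /cdim /cdim2; case: (_ + _)%N. Qed.

Lemma sign_tensor d (a : rawcell n d) (i : 'I_n.+1) (x : R) :
  (-1) ^+ (\sum_(j < n.+1 | (j < i)%N) cdim (a j))%N * (- (-1) ^+ cdim (a i) * x) =
  (-1) ^+ (\sum_(j < n.+1 | (j <= i)%N) cdim (a j)).+1 * x.
Proof.
rewrite [in RHS](bigD1 i) //= [in RHS](eq_bigl (fun j : 'I_n.+1 => (j < i)%N)); last first.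
  by move=> j /=; rewrite ltn_neqAle andbC.
by rewrite exprS exprD; ring.
Qed.

(** In the tensor product differential the sign is computed from the smaller cell
    a, with the additional sign of delta 1_a; here it is rewritten in terms of the
    larger cell b. The two additional dimensions in each [cdim2] do not matter. *)
Lemma odd_sum_cdim2 d (part : 'I_d.+1 -> 'I_n.+1) (a b : rawcell n d) (i : 'I_n.+1) :
    is_cell part a -> (forall j, j != i -> cdim2 a j = cdim2 b j) ->
    (cdim2 a i).+1 = cdim2 b i ->
  odd (\sum_(j < n.+1 | (j <= i)%N) cdim (a j)).+1 =
  odd (\sum_(j < n.+1 | (j <= i)%N) cdim2 b j).
Proof.
move=> /is_cellP[_ a1 _] ab ai.
rewrite (bigD1 i) // [in RHS](bigD1 i) // -ai -(cdim2E (a1 i)) -addSn.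
rewrite !oddD /= !negbK; congr (~~ _ (+) _).
apply: (big_ind2 (fun x y => odd x = odd y)) => //.
  by move=> x1 x2 y1 y2; rewrite !oddD => -> ->.
by move=> j /andP[_ ji]; rewrite -ab // -(cdim2E (a1 j)) /= negbK.
Qed.

Section Delta.
Variables (d : nat) (part : 'I_d.+1 -> 'I_n.+1).
Variables (a b : rawcell n d) (ac : is_cell part a) (bc : is_cell part b).

Lemma eq_del_vertex w i : w \in (b i).1 ->
  (a == del_vertex b w) =
  [forall (j | j != i), a j == b j] && (a i == ((b i).1 :\ w, (b i).2)%SET).
Proof.
have /is_cellP[b0 _ _] := bc; move=> wi.
have notin j : j != i -> (b j).1 :\ w = (b j).1.
  move=> ji; apply/finset.setDidPl; rewrite disjoint_sym disjoints1.
  by apply: contraNN ji => /b0 <-; rewrite (b0 _ _ wi).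
apply/eqP/andP => [->|[/forallP H /eqP ai]].
  rewrite ffunE eqxx; split=> //; apply/forallP => j; apply/implyP => ji.
  by rewrite ffunE notin // -surjective_pairing.
apply/ffunP => j; rewrite ffunE; have [->//|ji] := eqVneq j i.
by have /implyP/(_ ji)/eqP -> := H j; rewrite notin // -surjective_pairing.
Qed.

Lemma eq_del_apex i : (b i).2 ->
  (a == del_apex b i) = [forall (j | j != i), a j == b j] && (a i == ((b i).1, false)).
Proof.
move=> bi; apply/eqP/andP => [->|[/forallP H /eqP ai]].
  rewrite ffunE eqxx andbF eqxx; split=> //; apply/forallP => j; apply/implyP => ji.
  by rewrite ffunE ji andbT -surjective_pairing.
apply/ffunP => j; rewrite ffunE; have [->|ji] := eqVneq j i; first by rewrite andbF.
by have /implyP/(_ ji)/eqP -> := H j; rewrite andbT -surjective_pairing.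
Qed.

Lemma tcoefE : tcoef R a b =
  \sum_(w | w \in (b (part w)).1) (-1) ^+ vertex_exp part b w *+ (a == del_vertex b w)
  + \sum_(i | (b i).2) (-1) ^+ apex_exp b i *+ (a == del_apex b i).
Proof.
have /is_cellP[b0 b1 b2] := bc.
rewrite (partition_big part predT) //= [X in _ + X]big_mkcond -big_split /=.
apply: eq_bigr => i _.
rewrite sign_tensor /bcoef mulrDr mulrnDl; congr (_ + _).
  rewrite mulr_sumr -sumrMnl; apply: eq_big => [w|w wi].
    apply/idP/andP => [wi|[wi /eqP <-//]].
    by have pw := b0 _ _ wi; rewrite pw eqxx.
  rewrite (eq_del_vertex wi) mulrnAr -mulrnA mulnC mulnb -(eq_del_vertex wi).
  case: eqP => // ab; rewrite !mulr1n -exprD; apply: eq_sign.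
  have pw := b0 _ _ wi.
  rewrite /vertex_exp pw !oddD; congr (_ (+) _); apply: (odd_sum_cdim2 ac) => [j ji|].
    by rewrite ab (cdim2_del_vertex _ bc wi) (negbTE ji) addn0.
  by rewrite ab (cdim2_del_vertex _ bc wi) eqxx addn1.
case: ifP => bi; last by rewrite mulr0n mulr0 mul0rn.
rewrite /= mulrnAr -mulrnA mulnC mulnb -eq_del_apex //.
case: eqP => // ab; rewrite !mulr1n -exprD; apply: eq_sign.
rewrite oddD (@odd_sum_cdim2 d part a b i) // => [|j ji|].
- rewrite /apex_exp (bigD1 i) //= oddD (eq_bigl (fun j : 'I_n.+1 => (j < i)%N)); last first.
    by move=> j /=; rewrite ltn_neqAle andbC.
  rewrite /cdim2 bi addn1 /=.
  by case: (odd #|_|); case: (odd _).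
- by rewrite ab (cdim2_del_apex _ bi) (negbTE ji) addn0.
- by rewrite ab (cdim2_del_apex _ bi) eqxx addn1.
Qed.

End Delta.

Lemma raw_coef_delta d (part : 'I_d.+1 -> 'I_n.+1) (c : blowup R part) b :
    is_cell part b ->
  raw_coef (blowup_delta c) b =
    \sum_(w | w \in (b (part w)).1)
      (-1) ^+ vertex_exp part b w * raw_coef c (del_vertex b w)
    + \sum_(i | (b i).2) (-1) ^+ apex_exp b i * raw_coef c (del_apex b i).
Proof.
move=> bc.
rewrite -{1}[b]/(val (exist (is_cell part) b bc : cell part)) raw_coef_val ffunE /=.
under [LHS]eq_bigr => a _ do rewrite (tcoefE (valP a) bc) mulrDl !mulr_suml.
rewrite big_split /=; congr (_ + _); rewrite exchange_big /=; apply: eq_bigr => i _;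
  exact: raw_coef_sum.
Qed.

End Values.

(** * Values of families of cochains *)

Section Value.
Variables (RR : realType) (R : comPzRingType) (n : nat) (Y : filteredSpace n).
Implicit Types w : Defs.family RR R Y.

Definition value w d (s : fsimplex RR Y d) (b : rawcell n d) : R :=
  if @idP (regular s) is ReflectT r then raw_coef (w d (RSimplex r)) b else 0.

Lemma valueE w d (s : fsimplex RR Y d) (r : regular s) b :
  value w s b = raw_coef (w d (RSimplex r)) b.
Proof.
by rewrite /value; case: {-}_ / idP => // r'; rewrite (bool_irrelevance r r').
Qed.

Lemma value_rsimplex w d (s : rsimplex RR Y d) b : value w s b = raw_coef (w d s) b.
Proof. by case: s => s r; rewrite /= (valueE w r). Qed.

Lemma value_notcell w d (s : fsimplex RR Y d) b :
  ~~ is_cell (part s) b -> value w s b = 0.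
Proof. by rewrite /value; case: {-}_ / idP => // r; exact: raw_coef_notcell. Qed.

(** The last factor of a cell has no apex, so it contains a vertex. *)
Lemma cell_regular d (s : fsimplex RR Y d) b : is_cell (part s) b -> regular s.
Proof.
move=> /is_cellP[b0 b1 b2]; have := b1 ord_max.
rewrite b2 addn0 => /card_gt0P[v vb]; apply/existsP; exists v.
by rewrite (b0 _ _ vb).
Qed.

Lemma value_neq0 w d (s : fsimplex RR Y d) b : value w s b != 0 ->
  exists (r : regular s) (c : cell (part s)), val c = b /\ w d (RSimplex r) c != 0.
Proof.
move=> wb; have bc : is_cell (part s) b.
  by apply: contraNT wb => /value_notcell ->.
have r := cell_regular bc; exists r, (exist (is_cell (part s)) b bc); split=> //.
by rewrite -raw_coef_val -valueE.
Qed.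

Lemma value_delta w d (s : fsimplex RR Y d) b : is_cell (part s) b ->
  value (family_delta w) s b =
    \sum_(v | v \in (b (part s v)).1)
      (-1) ^+ vertex_exp (part s) b v * value w s (del_vertex b v)
    + \sum_(i | (b i).2) (-1) ^+ apex_exp b i * value w s (del_apex b i).
Proof.
move=> bc; have r := cell_regular bc.
by rewrite (valueE _ r) raw_coef_delta //; congr (_ + _);
  apply: eq_bigr => v _; rewrite (valueE _ r).
Qed.

(** The compatibility of a cochain with faces, with no regularity assumption: a
    cell that avoids the vertex l makes both simplices regular. *)
Lemma value_face k w d (l : 'I_d.+2) (s : fsimplex RR Y d.+1) (b : rawcell n d.+1) :
  blowup_cochain k w ->
  (forall i, l \notin (b i).1) ->
  value w s b = value w (face l s) (preim_cell (lift l) b).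
Proof.
move=> [_ wF] lb.
have surj i v : v \in (b i).1 -> exists u, lift l u = v.
  move=> vi; case: (unliftP l v) => [u ->|vl]; first by exists u.
  by have := lb i; rewrite -vl vi.
have cE : is_cell (part (face l s)) (preim_cell (lift l) b) = is_cell (part s) b.
  by rewrite -(is_cell_preim _ surj).
have [bc|bc] := boolP (is_cell (part s) b); last first.
  by rewrite !value_notcell // cE.
have bc' : is_cell (part (face l s)) (preim_cell (lift l) b) by rewrite cE.
have r := cell_regular bc; have r' := cell_regular bc'.
rewrite (valueE _ r) (valueE _ r') -(wF d l (RSimplex r) r').
rewrite -[X in raw_coef (blowup_face _ _) X]/(val (exist (is_cell _) _ bc')) raw_coef_val.
rewrite ffunE -raw_coef_val; congr raw_coef; apply/ffunP => i; rewrite !ffunE.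
rewrite [LHS]surjective_pairing /=; congr pair.
apply/setP => v; apply/idP/imsetP => [vi|[u ui ->]].
  by have [u uv] := surj i v vi; exists u => //; rewrite inE uv.
by move: ui; rewrite inE.
Qed.

End Value.

(** * Degeneracies of simplices *)

Section Degen.
Variable d : nat.
Implicit Types j w : 'I_d.+1.

Lemma degen_subproof j (v : 'I_d.+2) : (unbump j v < d.+1)%N.
Proof. by rewrite /unbump; have := ltn_ord v; have := ltn_ord j; lia. Qed.

Definition degen j (v : 'I_d.+2) : 'I_d.+1 := Ordinal (degen_subproof j v).

(** The two vertices over j: for a prism, its bottom copy and its top copy. *)
Definition lo j : 'I_d.+2 := widen_ord (leqnSn _) j.
Definition hi j : 'I_d.+2 := lift ord0 j.

Lemma nondec_degen j : nondec (degen j).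
Proof. by move=> u v /=; rewrite /unbump; lia. Qed.

Lemma degen_lo j u : degen j (lift (lo j) u) = u.
Proof. by apply: val_inj; rewrite /= bumpK. Qed.

Lemma degen_hi j u : degen j (lift (hi j) u) = u.
Proof. by apply: val_inj; rewrite /= /unbump /bump; lia. Qed.

Lemma lift_hi j : lift (hi j) j = lo j.
Proof. by apply: val_inj; rewrite /= /bump; lia. Qed.

Lemma degen_eq j w u : w != j -> (degen j u == w) = (u == lift (hi j) w).
Proof.
rewrite -!val_eqE /= /unbump /bump /= => wj.
by apply/eqP/eqP; move: wj => /eqP; lia.
Qed.

Lemma degen_loE j : degen j (lo j) = j.
Proof. by rewrite -{1}lift_hi degen_hi. Qed.

Lemma degen_hiE j : degen j (hi j) = j.
Proof. by apply: val_inj; rewrite /= /unbump /bump; lia. Qed.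

End Degen.

(** A face of a degeneracy: doubling the image of j and then taking the face over l
    amounts to taking the face l and then doubling j. The vertex
    [lift (hi (lift l j)) l] is the only one over l, since l is not doubled. *)
Lemma degen_face d (l : 'I_d.+2) (j : 'I_d.+1) v :
  lift l (degen j v) = degen (lift l j) (lift (lift (hi (lift l j)) l) v).
Proof.
apply: val_inj; rewrite /= /unbump /bump /=.
by have := ltn_ord l; have := ltn_ord j; lia.
Qed.

Lemma degen_face_lt d (l : 'I_d.+2) (j : 'I_d.+1) (v : 'I_d.+2) :
  (lift l j < lift (lift (hi (lift l j)) l) v)%N = (j < v)%N.
Proof.
rewrite /= /bump /=.
by have := ltn_ord l; have := ltn_ord j; lia.
Qed.

(** * Signs of the prism operator *)

Section Signs.
Variables (n d : nat) (part : 'I_d.+1 -> 'I_n.+1).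
Implicit Types (F : {set 'I_d.+1}) (b : rawcell n d) (j w : 'I_d.+1).

Lemma count_belowE m (F : {set 'I_m.+1}) x :
  count_below F x = (\sum_(u : 'I_m.+1) ((u \in F) && (u < x)))%N.
Proof. by rewrite /count_below -sum1_card big_mkcond. Qed.

Lemma count_below_del F w x :
  count_below F x = ((w \in F) && (w < x) + count_below (F :\ w)%SET x)%N.
Proof.
rewrite !count_belowE (bigD1 w) //= [in RHS](bigD1 w) //= !inE eqxx add0n; congr addn.
by apply: eq_bigr => u uw; rewrite !inE uw.
Qed.

Lemma count_below_degen_lift F j w :
  count_below (degen j @^-1: F)%SET (lift (hi j) w) =
  (count_below F w + ((j \in F) && (j < w)))%N.
Proof.
rewrite !count_belowE (bigD1_ord (hi j)) //= inE degen_hiE addnC; congr addn; last first.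
  by congr (nat_of_bool (_ && _)); rewrite /bump; lia.
by apply: eq_bigr => u _; rewrite inE degen_hi ltnNge leq_bump2 -ltnNge.
Qed.

Lemma count_below_degen_hi F j :
  count_below (degen j @^-1: F)%SET (hi j) = (count_below F j + (j \in F))%N.
Proof.
rewrite !count_belowE (bigD1_ord (lo j)) //= inE degen_loE addnC; congr addn; last first.
  by rewrite /bump /= ltnSn andbT.
apply: eq_bigr => u _; rewrite inE degen_lo; congr (nat_of_bool (_ && _)).
by rewrite /bump /=; lia.
Qed.

Lemma card_degen F j : #|degen j @^-1: F|%SET = (#|F| + (j \in F))%N.
Proof.
have cE m (G : {set 'I_m.+1}) : #|G| = (\sum_u (u \in G))%N.
  by rewrite -sum1_card big_mkcond.
rewrite !cE (bigD1_ord (hi j)) //= inE degen_hiE addnC; congr addn.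
by apply: eq_bigr => u _; rewrite inE degen_hi.
Qed.

Lemma sum_add_indicator (P : pred 'I_n.+1) (f g : 'I_n.+1 -> nat) q :
  (forall k, f k = g k + (k == q))%N ->
  (\sum_(k | P k) f k = \sum_(k | P k) g k + P q)%N.
Proof.
move=> fg; under eq_bigr do rewrite fg.
rewrite big_split /=; congr addn; rewrite big_mkcond (bigD1 q) //= eqxx.
rewrite big1 ?addn0; first by case: (P q).
by move=> k /negbTE ->; case: (P k).
Qed.

Section Cell.
Variables (b : rawcell n d) (bc : is_cell part b) (j : 'I_d.+1).
Hypothesis jb : j \in (b (part j)).1.

Lemma cdim2_degen k : cdim2 (preim_cell (degen j) b) k = (cdim2 b k + (k == part j))%N.
Proof.
rewrite /cdim2 ffunE /= card_degen (cell_disjoint k bc jb).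
by rewrite addSn addnAC.
Qed.

Lemma vertex_exp_degen_lift w :
  vertex_exp (part \o degen j) (preim_cell (degen j) b) (lift (hi j) w) =
  (vertex_exp part b w + (part j <= part w) + ((part w == part j) && (j < w)))%N.
Proof.
rewrite /vertex_exp /= degen_hi (sum_add_indicator _ cdim2_degen) ffunE.
rewrite count_below_degen_lift (cell_disjoint _ bc jb).
by rewrite -!addnA; congr addn; rewrite addnCA.
Qed.

Lemma vertex_exp_degen_hi :
  vertex_exp (part \o degen j) (preim_cell (degen j) b) (hi j) = (vertex_exp part b j).+2.
Proof.
rewrite /vertex_exp /= degen_hiE (sum_add_indicator _ cdim2_degen) ffunE.
by rewrite count_below_degen_hi jb leqnn !addn1 addSn addnS.
Qed.

Lemma vertex_exp_degen_lo :
  vertex_exp (part \o degen j) (preim_cell (degen j) b) (lo j) = (vertex_exp part b j).+1.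
Proof. by rewrite -lift_hi vertex_exp_degen_lift leqnn ltnn andbF addn0 addn1. Qed.

Lemma apex_exp_degen i :
  apex_exp (preim_cell (degen j) b) i = (apex_exp b i + (part j < i))%N.
Proof. exact: (sum_add_indicator _ cdim2_degen). Qed.

Lemma vertex_exp_del_vertex w : w \in (b (part w)).1 -> vertex_exp part b j =
  (vertex_exp part (del_vertex b w) j + (part w <= part j)
   + ((part j == part w) && (w < j)))%N.
Proof.
move=> wb; rewrite /vertex_exp (sum_add_indicator _ (fun k => cdim2_del_vertex k bc wb)).
rewrite ffunE /= (count_below_del _ w) (cell_disjoint _ bc wb).
by rewrite -!addnA; congr addn; rewrite addnA addnC.
Qed.

Lemma vertex_exp_del_apex i : (b i).2 ->
  vertex_exp part b j = (vertex_exp part (del_apex b i) j + (i <= part j))%N.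
Proof.
move=> bi; rewrite /vertex_exp (sum_add_indicator _ (fun k => cdim2_del_apex k bi)).
by rewrite ffunE addnAC.
Qed.

(** Deleting w and doubling j both have odd degree, so they anticommute. *)
Lemma sign_del_vertex_degen (R : comPzRingType) w : w \in (b (part w)).1 -> w != j ->
  (-1) ^+ vertex_exp part b w * (-1) ^+ vertex_exp part (del_vertex b w) j =
  - ((-1) ^+ vertex_exp part b j *
     (-1) ^+ vertex_exp (part \o degen j) (preim_cell (degen j) b) (lift (hi j) w)) :> R.
Proof.
move=> wb wj; rewrite -!exprD; apply: sign_neq.
rewrite vertex_exp_degen_lift (vertex_exp_del_vertex wb).
move: (vertex_exp part b w) (vertex_exp part (del_vertex b w) j) => x y.
rewrite !oddD !oddb.
have -> : (w < j)%N = ~~ (j < w)%N by rewrite -leqNgt ltn_neqAle val_eqE wj.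
rewrite [part j == _]eq_sym -val_eqE /=; move: (j < w)%N => z.
by case: ltngtP => _; case: (odd x); case: (odd y); case: z.
Qed.

Lemma sign_del_apex_degen (R : comPzRingType) i : (b i).2 ->
  (-1) ^+ apex_exp b i * (-1) ^+ vertex_exp part (del_apex b i) j =
  - ((-1) ^+ vertex_exp part b j * (-1) ^+ apex_exp (preim_cell (degen j) b) i) :> R.
Proof.
move=> bi; rewrite -!exprD; apply: sign_neq.
rewrite apex_exp_degen (vertex_exp_del_apex bi).
move: (apex_exp b i) (vertex_exp part (del_apex b i) j) => x y.
rewrite !oddD !oddb ltnNge.
by case: (odd x); case: (odd y); case: (_ <= _)%N.
Qed.

End Cell.
End Signs.

(** * Prisms over a simplex *)

Section Prism.
Variables (RR : realType) (n : nat) (X : filteredSpace n) (r : RR).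
Notation Y := (prodR RR X).

Definition prism d (j : 'I_d.+1) (s : fsimplex RR Y d) : fsimplex RR Y d.+1 :=
  sweep r (fun v : 'I_d.+2 => (j < v)%N) s (nondec_degen j).

Definition tilt d (m : nat) (s : fsimplex RR Y d) : fsimplex RR Y d :=
  sweep r (fun v : 'I_d.+1 => (m <= v)%N) s (@nondec_id d).

Lemma face_lo_prism d (j : 'I_d.+1) (s : fsimplex RR Y d) :
  face (lo j) (prism j s) = tilt j s.
Proof.
rewrite face_sweep; apply: sweep_eq => u; first exact: degen_lo.
by rewrite /= /bump /=; lia.
Qed.

Lemma face_hi_prism d (j : 'I_d.+1) (s : fsimplex RR Y d) :
  face (hi j) (prism j s) = tilt j.+1 s.
Proof.
rewrite face_sweep; apply: sweep_eq => u; first exact: degen_hi.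
by rewrite /= /bump /=; lia.
Qed.

Lemma prism_face d (l : 'I_d.+2) (j : 'I_d.+1) (s : fsimplex RR Y d.+1) :
  prism j (face l s) = face (lift (hi (lift l j)) l) (prism (lift l j) s).
Proof.
rewrite [LHS]sweep_face [RHS]face_sweep; apply: sweep_eq => u /=.
  exact: degen_face.
by rewrite -(degen_face_lt l j u).
Qed.

Lemma tilt_top d (s : fsimplex RR Y d) : tilt d.+1 s = s.
Proof.
rewrite -[RHS](sweep0 r); apply: sweep_eq => // u /=.
by apply/negbTE; rewrite -ltnNge.
Qed.

Lemma tilt_bottom (p : perversity Y) d (s : fsimplex RR Y d) :
  tilt 0 s = fsimplex_comp (pvmap_comp (slice_map p r) (pr_map p)) s.
Proof. by rewrite -sweep1; exact: sweep_eq. Qed.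

(** Strata of the product are of the form S' x R. *)
Lemma sset_prodR (S : stratum Y) x t t' : sset S (x, t) -> sset S (x, t').
Proof.
move=> Sx; have := stratum_layer Sx; rewrite layer_prodR => -[/= xi _].
rewrite (stratum_component Sx) component_prodR //; split=> //=.
exact: connected_component_refl.
Qed.

Lemma prism_meets_stratum (S : stratum Y) d (j : 'I_d.+1) (s : fsimplex RR Y d) :
  (range s `&` sset S !=set0 -> range (prism j s) `&` sset S !=set0)%classic.
Proof.
move=> [_ [[t _ <-] St]]; exists (prism j s (push (lift (hi j)) t)); split.
  by exists (push (lift (hi j)) t).
rewrite /= push_comp (_ : degen j \o _ = id); last by apply/funext => u; exact: degen_hi.
by rewrite push_id; apply: (@sset_prodR _ _ (s t).2); rewrite -surjective_pairing.
Qed.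

End Prism.

(** * The prism operator on cochains *)

Section Homotopy.
Variables (RR : realType) (R : comPzRingType) (n : nat) (X : filteredSpace n) (r : RR).
Notation Y := (prodR RR X).
Implicit Types w : Defs.family RR R Y.

Definition prism_op w : Defs.family RR R Y := fun d s =>
  [ffun a : cell (part s) => \sum_(j | j \in (val a (part s j)).1)
     (-1) ^+ vertex_exp (part s) (val a) j *
     value w (prism r j s) (preim_cell (degen j) (val a))].

Lemma is_cell_degen d (part : 'I_d.+1 -> 'I_n.+1) (b : rawcell n d) j :
  is_cell (part \o degen j) (preim_cell (degen j) b) = is_cell part b.
Proof.
by apply: is_cell_preim => _ v _; exists (lift (hi j) v); rewrite degen_hi.
Qed.

Lemma value_prism_op w d (s : fsimplex RR Y d) b : value (prism_op w) s b =
  \sum_(j | j \in (b (part s j)).1)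
     (-1) ^+ vertex_exp (part s) b j * value w (prism r j s) (preim_cell (degen j) b).
Proof.
have [bc|bc] := boolP (is_cell (part s) b); last first.
  rewrite value_notcell // big1 // => j _.
  by rewrite value_notcell ?mulr0 // (is_cell_degen (part s)).
have reg := cell_regular bc.
rewrite (valueE _ reg) -[b]/(val (exist (is_cell (part s)) b bc)) raw_coef_val ffunE.
by [].
Qed.

(** The tilts telescope: consecutive ones are the two faces of a prism that delete
    a copy of the doubled vertex. *)
Lemma homotopy_identity k w d (s : fsimplex RR Y d) b :
    blowup_cochain k w -> is_cell (part s) b ->
  value (family_delta (prism_op w)) s b + value (prism_op (family_delta w)) s b =
  value w s b - value w (tilt r 0 s) b.
Proof.
move=> wN bc.
pose V j c := value w (prism r j s) c.
pose b' j := preim_cell (degen j) b.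
pose P := [pred j | j \in (b (part s j)).1].
have inP j i : j \in (b i).1 -> P j.
  by have /is_cellP[b0 _ _] := bc; move=> ji; rewrite inE (b0 _ _ ji).
pose G m := value w (tilt r m s) b.
have G_hi j : V j (del_vertex (b' j) (hi j)) = G j.+1.
  rewrite /V (value_face (l := hi j) _ wN); last by move=> i; rewrite ffunE !inE eqxx.
  rewrite face_hi_prism; congr value; apply/ffunP => i; rewrite !ffunE /=.
  rewrite [RHS]surjective_pairing; congr pair; apply/setP => u.
  by rewrite !inE degen_hi eq_sym (negbTE (neq_lift _ _)).
have G_lo j : V j (del_vertex (b' j) (lo j)) = G j.
  rewrite /V (value_face (l := lo j) _ wN); last by move=> i; rewrite ffunE !inE eqxx.
  rewrite face_lo_prism; congr value; apply/ffunP => i; rewrite !ffunE /=.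
  rewrite [RHS]surjective_pairing; congr pair; apply/setP => u.
  by rewrite !inE degen_lo eq_sym (negbTE (neq_lift _ _)).
(* If j is not a vertex of b, both tilts are read off the same cell of a prism. *)
have G_out j : ~~ P j -> G j.+1 = G j.
  move=> jP; rewrite -G_hi -G_lo; congr V; apply/ffunP => i; rewrite !ffunE.
  have ji : j \notin (b i).1 by apply: contra jP; exact: inP.
  congr pair; apply/setP => u; rewrite !inE.
  case: (eqVneq u (hi j)) => [->|_]; first by rewrite degen_hiE (negbTE ji) !andbF.
  case: (eqVneq u (lo j)) => [->|_ //]; by rewrite degen_loE (negbTE ji) !andbF.
rewrite value_delta // value_prism_op.
(* A1 and A2 are the terms in which the deleted vertex, or apex, is not the doubled
   vertex; they occur with opposite signs in the two composites. *)
pose A1 := \sum_(j | P j) \sum_(v | P v && (v != j))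
   (-1) ^+ vertex_exp (part s) b v * (-1) ^+ vertex_exp (part s) (del_vertex b v) j *
   V j (preim_cell (degen j) (del_vertex b v)).
pose A2 := \sum_(j | P j) \sum_(i | (b i).2)
   (-1) ^+ apex_exp b i * (-1) ^+ vertex_exp (part s) (del_apex b i) j *
   V j (preim_cell (degen j) (del_apex b i)).
have -> : \sum_(v | v \in (b (part s v)).1)
    (-1) ^+ vertex_exp (part s) b v * value (prism_op w) s (del_vertex b v) = A1.
  under eq_bigr => v _ do rewrite value_prism_op mulr_sumr.
  rewrite /A1 (exchange_big_dep P) //=; last first.
    by move=> v j _; rewrite ffunE inE => /andP[].
  apply: eq_bigr => j jP; apply: eq_big => [v|v _]; last by rewrite mulrA.
  by rewrite ffunE !inE; case: (v \in _) => //=; rewrite eq_sym jP andbT.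
have -> : \sum_(i | (b i).2)
    (-1) ^+ apex_exp b i * value (prism_op w) s (del_apex b i) = A2.
  under eq_bigr => i _ do rewrite value_prism_op mulr_sumr.
  rewrite /A2 (exchange_big_dep P) //=; last first.
    by move=> i j _; rewrite ffunE.
  apply: eq_bigr => j jP; apply: eq_big => [i|i _]; last by rewrite mulrA.
  by rewrite ffunE /= jP andbT.
have -> : \sum_(j | j \in (b (part s j)).1) (-1) ^+ vertex_exp (part s) b j *
     value (family_delta w) (prism r j s) (preim_cell (degen j) b) =
   \sum_(j | P j) (G j.+1 - G j) - A1 - A2.
  rewrite -!sumrB; apply: eq_bigr => j jP.
  rewrite value_delta ?(is_cell_degen (part s)) //.
  rewrite -/(b' j) mulrDr; congr (_ + _); last first.
    rewrite -sumrN mulr_sumr; apply: eq_big => [i|i bi]; first by rewrite ffunE.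
    rewrite mulrA preim_cell_del_apex -mulNr; congr (_ * _).
    have bi' : (b i).2 by move: bi; rewrite ffunE.
    by rewrite (sign_del_apex_degen bc jP R bi') opprK.
  (* The vertices of the doubled cell: hi j, lo j, and those over some v != j. *)
  rewrite (bigD1_ord (hi j)) /=; last by rewrite ffunE inE degen_hiE.
  rewrite (bigD1 j) /=; last by rewrite degen_hi ffunE inE degen_hi.
  rewrite lift_hi -[value w _ _]/(V j _) G_hi.
  rewrite -[value w _ (del_vertex _ (lo j))]/(V j _) G_lo.
  rewrite !mulrDr addrA; congr (_ + _).
    rewrite vertex_exp_degen_hi // vertex_exp_degen_lo // !exprS.
    have : (-1) ^+ vertex_exp (part s) b j * (-1) ^+ vertex_exp (part s) b j = 1 :> R.
      by rewrite -exprD addnn -signr_odd odd_double.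
    move: ((-1) ^+ vertex_exp (part s) b j) => x xx.
    transitivity (x * x * G j.+1 - x * x * G j); first by ring.
    by rewrite xx !mul1r.
  rewrite -sumrN mulr_sumr; apply: eq_big => [v|v].
    by rewrite degen_hi ffunE inE degen_hi.
  rewrite degen_hi ffunE inE degen_hi => /andP[vP vj].
  rewrite mulrA -mulNr (sign_del_vertex_degen bc jP R vP vj) opprK; congr (_ * _).
  rewrite /V (@preim_cell_del_vertex _ _ _ _ b v (lift (hi j) v)) // => u.
  exact: degen_eq.
have -> : \sum_(j | P j) (G j.+1 - G j) = \sum_(0 <= m < d.+1) (G m.+1 - G m).
  rewrite big_mkord [LHS]big_mkcond; apply: eq_bigr => j _.
  by case: ifP => // /negbT/G_out ->; rewrite subrr.
rewrite telescope_sumr // /G tilt_top.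
by ring.
Qed.

(** What degree and allowability need to know: a non-zero coefficient of
    [prism_op w] comes from one of w at a cell with the same apexes and one more
    dimension in a single factor. *)
Lemma prism_op_neq0 w d (s : fsimplex RR Y d) (reg : regular s) (a : cell (part s)) :
  prism_op w (RSimplex reg) a != 0 ->
  exists (j : 'I_d.+1) (reg' : regular (prism r j s)) (c : cell (part (prism r j s))),
    [/\ w d.+1 (RSimplex reg') c != 0, forall k, (val c k).2 = (val a k).2 &
        forall k, cdim (val c k) = (cdim (val a k) + (k == part s j))%N].
Proof.
rewrite ffunE => a0.
have [j ja wj] : exists2 j, j \in (val a (part s j)).1 &
    value w (prism r j s) (preim_cell (degen j) (val a)) != 0.
  apply/exists_inP; apply: contraNT a0 => /exists_inPn H.
  by rewrite big1 // => j ja; have := H j ja; rewrite negbK => /eqP ->; rewrite mulr0.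
have [reg' [c [cE wc]]] := value_neq0 wj; exists j, reg', c; split=> // k.
  by rewrite cE ffunE.
have /is_cellP[_ a1 _] := valP a; have /is_cellP[_ c1 _] := valP c.
apply: succn_inj; apply: succn_inj; rewrite (cdim2E (c1 k)) -2!addSn (cdim2E (a1 k)).
by rewrite cE (cdim2_degen (valP a) ja).
Qed.

(** Compatibility with the face l: on a cell of that face the sum is indexed by the
    vertices [lift l j], and there the prisms match by [prism_face]. *)
Lemma prism_op_cochain k w : blowup_cochain k.+1 w -> blowup_cochain k (prism_op w).
Proof.
move=> wN; have [wD _] := wN; split.
  move=> d [s reg] a /prism_op_neq0[j [reg' [c [wc _ ec]]]].
  have := wD _ _ _ wc; rewrite /cell_dim (sum_add_indicator _ ec) => /eqP.
  by rewrite addn1 eqSS => /eqP.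
move=> d l s reg; apply/ffunP => a; rewrite !ffunE.
rewrite big_mkcond (bigD1_ord l) //= ifF ?add0r; last first.
  apply/negbTE; rewrite ffunE /=; apply/imsetP => -[u _ /eqP].
  by rewrite (negbTE (neq_lift _ _)).
rewrite [RHS]big_mkcond /=; apply: eq_bigr => j _.
rewrite ffunE /= mem_imset; last exact: lift_inj.
case: ifP => // ja; congr (_ * _).
  congr (_ ^+ _); rewrite /vertex_exp /=; congr addn.
    by apply: eq_bigr => i _; rewrite /cdim2 ffunE /= card_imset //; exact: lift_inj.
  rewrite !count_belowE (bigD1_ord l) //= ffunE /=.
  rewrite (_ : (l \in _) = false) ?add0n; last first.
    by apply/imsetP => -[u _ /eqP]; rewrite (negbTE (neq_lift _ _)).
  apply: eq_bigr => u _; rewrite mem_imset; last exact: lift_inj.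
  by rewrite ltnNge leq_bump2 -ltnNge.
rewrite (value_face (l := lift (hi (lift l j)) l) _ wN); last first.
  move=> i; rewrite !ffunE inE degen_hi /=; apply/imsetP => -[u _ /eqP].
  by rewrite (negbTE (neq_lift _ _)).
rewrite -prism_face; congr value; rewrite preim_cell_comp.
apply/ffunP => i; rewrite !ffunE; congr pair; apply/setP => u.
by rewrite !inE /= -degen_face mem_imset //; exact: lift_inj.
Qed.

Lemma prism_op_allowable (p : perversity Y) w : allowable p w -> allowable p (prism_op w).
Proof.
move=> /allowableP wp; apply/allowableP => S d [s reg] a Ss sS.
move=> /prism_op_neq0[j [reg' [c [wc e2 ec]]]].
have cS : (cell_norm (codim S) c <= p S)%E.
  exact: (wp S d.+1 (RSimplex reg') c Ss (prism_meets_stratum r j sS) wc).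
apply: le_trans cS.
rewrite /cell_norm e2; case: ifP => // _.
by rewrite lee_fin lez_nat; apply: leq_sum => i _; rewrite ec leq_addr.
Qed.

Variable p : perversity Y.
Let f : perverse_map p p := pvmap_comp (slice_map p r) (pr_map p).

Lemma prism_op_homotopy k w : blowup_cochain k w ->
  family_delta (prism_op w) + prism_op (family_delta w) = w - pullback f w.
Proof.
move=> wN; apply: Defs.familyP => d s; apply/ffunP => a.
have := homotopy_identity (s := s) wN (valP a).
rewrite (tilt_bottom r p) -[fsimplex_comp _ _]/(rfsimplex (rsimplex_comp f s)).
rewrite !value_rsimplex !raw_coef_val => H.
by rewrite ffunE [RHS]ffunE [X in _ = _ + X]ffunE.
Qed.

Lemma prism_op_cocycle k w : intersection_cochain p k w -> family_delta w = 0 ->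
  family_delta (prism_op w) = w - pullback f w.
Proof.
move=> [wN _ _] w0; rewrite -(prism_op_homotopy wN) w0 (_ : prism_op 0 = 0) ?addr0 //.
apply: Defs.familyP => d s; apply/ffunP => a; rewrite !ffunE big1 // => j _.
suff -> : value (0 : Defs.family RR R Y) (prism r j s) (preim_cell (degen j) (val a)) = 0.
  by rewrite mulr0.
apply/eqP; apply: contraT => /value_neq0[reg [c [_]]]; by rewrite ffunE eqxx.
Qed.

(** The coboundary is allowable because it equals w - f^* w. *)
Lemma prism_op_intersection k w : intersection_cochain p k.+1 w -> family_delta w = 0 ->
  intersection_cochain p k (prism_op w).
Proof.
move=> wI w0; have [wN wA _] := wI; split; first exact: prism_op_cochain.
  exact: prism_op_allowable.
rewrite (prism_op_cocycle wI w0).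
have := allowable_lin (-1) (pullback_allowable f wA) wA.
by rewrite scaleN1r addrC.
Qed.

(** Doubling a vertex raises the dimension of a cell, so no cell of dimension 0 is
    reached. *)
Lemma prism_op_degree0 w : blowup_cochain 0 w -> prism_op w = 0.
Proof.
move=> [wD _]; apply: Defs.familyP => d [s reg]; apply/ffunP => a.
rewrite [RHS]ffunE; apply/eqP; apply: contraT => /prism_op_neq0[j [reg' [c [wc _ ec]]]].
by have := wD _ _ _ wc; rewrite /cell_dim (sum_add_indicator _ ec) addn1.
Qed.

Lemma cohomology_map_retraction k :
  cohomology_map RR R f k =1 (id : cohomology RR R p k -> cohomology RR R p k).
Proof.
move=> c; rewrite /= -(coclass_repr c) cohomology_map_coclass.
move: (repr c) => {c} z.
have /asboolP[zI z0] := coval_in z.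
apply/esym/coclass_eq/asboolP; case: k z zI z0 => [|k] z zI z0.
  (* In degree 0 there are no coboundaries: z must equal its pullback. *)
  have [zN _ _] := zI; apply: val_inj => /=.
  by rewrite -(prism_op_cocycle zI z0) prism_op_degree0 ?linear0.
by exists (prism_op z); [exact: prism_op_intersection|exact: (prism_op_cocycle zI z0)].
Qed.

End Homotopy.

Theorem theorem4 (RR : realType) (R : comPzRingType) (n : nat)
    (X : filteredSpace n) (p : perversity (prodR RR X)) (k : nat) :
  let I0_pr : perverse_map p p := pvmap_comp (slice_map p 0) (pr_map p) in
  let I1_pr : perverse_map p p := pvmap_comp (slice_map p 1) (pr_map p) in
  cohomology_map RR R I0_pr k =1 cohomology_map RR R I1_pr k /\
  cohomology_map RR R I1_pr k =1 (id : cohomology RR R p k -> cohomology RR R p k).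
Proof.
by move=> I0_pr I1_pr; split=> c; rewrite !cohomology_map_retraction.
Qed.
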